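(* Let $p,q\ge 1$ be integers and $n=p+q$. The formula $$ (A,X)\ast(\pi,Y)=(A\pi,\,AY+2\,\mathrm{pr}_{A\pi}X),\qquad (A,X)\in SE(n),\ \pi\in G(n,p),\ Y\in\pi\subset\mathbb{R}^n, $$ defines a transitive $SE(n)$-action on the canonical vector bundle $\mathcal C_{n,p}$ over $G(n,p)$ such that $\rho:\mathcal S_p\to\mathcal C_{n,p}$ becomes an $SE(n)$-equivariant diffeomorphism: $$ \rho((A,X)\bullet(R,Y))=(A,X)\ast\rho(R,Y),\qquad (A,X)\in SE(n),\ (R,Y)\in\mathcal S_p. $$ Therefore, this $SE(n)$-action realizes $\mathcal C_{n,p}$ as the non-compact affine symmetric space $(SE(n),\,S(O(p)\times O(q))\otimes_s\mathbb{R}^q,\,\sigma)$; that is, $\mathcal C_{n,p}$ with the action $\ast$ is $SE(n)$-equivariantly diffeomorphic to $SE(n)/\bigl(S(O(p)\times O(q))\otimes_s\mathbb{R}^q\bigr)$, where $S(O(p)\times O(q))\otimes_s\mathbb{R}^q=SE(n)^\sigma$ is the fixed point subgroup of the involutive automorphism $\sigma$.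
   Context: $SE(n)=SO(n)\otimes_s\mathbb{R}^n$ (semidirect product) is the Lie group of pairs $(R,X)$, $R\in SO(n)$, $X\in\mathbb{R}^n$, with multiplication $(R_1,X_1)\cdot(R_2,X_2)=(R_1R_2,X_1+R_1X_2)$, identified with the matrices $\begin{pmatrix}R&X\\0&1\end{pmatrix}$. $J_{p,q}=\begin{pmatrix}-\mathbb{I}_p&0\\0&\mathbb{I}_q\end{pmatrix}$, where $\mathbb{I}_k$ is the $k\times k$ identity matrix, and $\sigma:SE(n)\to SE(n)$ is $\sigma((R,X))=(J_{p,q}RJ_{p,q},J_{p,q}X)$. The subgroup $S(O(p)\times O(q))\otimes_s\mathbb{R}^q\subset SE(n)$ consists of the matrices $\begin{pmatrix}A&0&0\\0&B&X\\0&0&1\end{pmatrix}$ with $A\in O(p)$, $B\in O(q)$, $\det A\cdot\det B=1$, $X\in\mathbb{R}^q$. An affine symmetric space is a triple $(G,H,\sigma)$ where $G$ is a connected Lie group, $\sigma$ is an involutive automorphism of $G$, and $H$ is a closed subgroup lying between the fixed point subgroup $G^\sigma$ and its identity component. The $\sigma$-twisted conjugation action is $g\bullet h=g\cdot h\cdot\sigma(g^{-1})$, explicitly $(A,X)\bullet(R,Y)=(ARJ_{p,q}A^{-1}J_{p,q},\,X+AY-ARJ_{p,q}A^{-1}X)$, and $$ \mathcal S_p=SE(n)\bullet(\mathbb{I}_n,0)=\{(AJ_{p,q}A^{-1}J_{p,q},\,X-AJ_{p,q}A^{-1}X)\,\vert\,(A,X)\in SE(n)\}, $$ regarded as a submanifold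 of $SE(n)$. $G(n,p)$ is the Grassmannian of $p$-dimensional linear subspaces $\pi\subset\mathbb{R}^n$, and $\mathcal C_{n,p}=\{(\pi,X)\in G(n,p)\times\mathbb{R}^n\,\vert\,X\in\pi\}$ is the canonical vector bundle over $G(n,p)$. For a subspace $\pi\subset\mathbb{R}^n$, $\mathrm{pr}_\pi$ is the orthogonal projection onto $\pi$ with respect to the Euclidean inner product. The map $\rho:\mathcal S_p\to\mathcal C_{n,p}$ is $\rho(R,Y)=(\rho_0(R),Y)$, where $\rho_0(R)$ is the $(-1)$-eigenspace of $RJ_{p,q}$, i.e. $\rho_0(R)=\{Z\in\mathbb{R}^n\,\vert\,RJ_{p,q}Z=-Z\}$; for $R=AJ_{p,q}A^{-1}J_{p,q}$ with $A\in SO(n)$ this is the $p$-dimensional plane spanned by $AE_1,\dots,AE_p$, where $E_1,\dots,E_n$ is the standard basis of $\mathbb{R}^n$. *)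

(* Defs.v *)
From HB Require Import structures.
From mathcomp Require Import all_boot all_order all_algebra all_fingroup.
From mathcomp Require Import all_classical all_reals all_analysis.

Set Implicit Arguments.
Unset Strict Implicit.
Unset Printing Implicit Defensive.

Import Order.TTheory GRing.Theory Num.Theory.
Import numFieldNormedType.Exports.

Local Open Scope classical_set_scope.
Local Open Scope ring_scope.

(* MathComp / MathComp-Analysis, over an arbitrary R : realType.              *)
(* A manifold is a set of points of some ambient type together with a set of  *)
(* local parametrizations, i.e. inverses of charts, as in do Carmo's          *)
(* Riemannian Geometry. Its topology is the one induced by parametrizations.  *)

Section Smooth.
Context {R : realType}.

(* To be used for U open and V of finite dimension. *)
Fixpoint Ck (k : nat) {V W : normedModType R} (U : set V) (f : V -> W) : Prop :=
  match k with
  | 0%N => forall x, U x -> {for x, continuous f}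
  | k'.+1 => (forall x, U x -> differentiable f x) /\
             (forall v : V, Ck k' U (fun x => 'D_v f x : W))
  end.

Definition smooth_on {V W : normedModType R} (U : set V) (f : V -> W) : Prop :=
  forall k, Ck k U f.

(* On an arbitrary subset S: smooth local extensions exist at points of S. *)
Definition smooth_subset {V W : normedModType R} (S : set V) (f : V -> W) :=
  forall x, S x -> exists (O : set V) (g : V -> W),
    [/\ open O, O x, smooth_on O g & forall y, S y -> O y -> g y = f y].

(* Only the values of pfun on pdom are relevant. *)
Record local_param (T : Type) (d : nat) := LocalParam {
  pdom : set 'rV[R]_d;
  pfun : 'rV[R]_d -> T }.

Record premanifold (T : Type) := PreManifold {
  mpoints : set T;
  mdim : nat;
  mparam : set (local_param T mdim) }.
Arguments mparam {T} p.

Section MapsAndTopology.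
Context {T T' : Type}.

(* f is smooth at every point of M lying in W: read through parametrizations  *)
(* a of M and b of N, f is locally a smooth map h between open sets.          *)
Definition smooth_map (M : premanifold T) (N : premanifold T') (W : set T)
    (f : T -> T') : Prop :=
  (forall x, mpoints M x -> W x -> mpoints N (f x)) /\
  (forall a b u v, mparam M a -> mparam N b -> pdom a u -> pdom b v ->
    W (pfun a u) -> f (pfun a u) = pfun b v ->
    exists (O : set 'rV[R]_(mdim M)) (h : 'rV[R]_(mdim M) -> 'rV[R]_(mdim N)),
      [/\ open O, O u, O `<=` pdom a, smooth_on O h &
        forall w, O w -> pdom b (h w) /\ f (pfun a w) = pfun b (h w)]).

Definition mopen (M : premanifold T) (O : set T) : Prop :=
  O `<=` mpoints M /\
  forall a, mparam M a -> open (pdom a `&` [set u | O (pfun a u)]).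

Definition mcompact (M : premanifold T) : Prop :=
  forall F : set (set T), (forall O, F O -> mopen M O) ->
    mpoints M `<=` \bigcup_(O in F) O ->
    exists F' : set (set T),
      [/\ finite_set F', F' `<=` F & mpoints M `<=` \bigcup_(O in F') O].

End MapsAndTopology.

Definition covers {T : Type} {d : nat} (A : set (local_param T d)) (X : set T) :=
  forall x, X x -> exists2 a, A a & exists2 u, pdom a u & pfun a u = x.

Record is_manifold {T : Type} (M : premanifold T) : Prop := IsManifold {
  param_ok : forall a, mparam M a ->
    [/\ open (pdom a),
        forall u, pdom a u -> mpoints M (pfun a u) &
        forall u u', pdom a u -> pdom a u' -> pfun a u = pfun a u' -> u = u'];
  param_cover : covers (mparam M) (mpoints M);
  param_compatible : smooth_map M M setT idfun;
  manifold_hausdorff : forall x y, mpoints M x -> mpoints M y -> x <> y ->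
    exists O O' : set T,
      [/\ mopen M O, mopen M O', O x, O' y & O `&` O' = set0];
  manifold_second_countable : exists A,
    [/\ countable A, A `<=` mparam M & covers A (mpoints M)] }.

Definition diffeomorphism {T T' : Type} (M : premanifold T)
    (N : premanifold T') (f : T -> T') : Prop :=
  [/\ is_manifold M, is_manifold N, smooth_map M N setT f &
    exists g : T' -> T,
      [/\ smooth_map N M setT g,
          forall x, mpoints M x -> g (f x) = x &
          forall y, mpoints N y -> f (g y) = y]].

Definition prod_manifold {T T' : Type} (M : premanifold T)
    (N : premanifold T') : premanifold (T * T') :=
  @PreManifold (T * T')%type (mpoints M `*` mpoints N) (mdim M + mdim N)
    [set c | exists a b, [/\ mparam M a, mparam N b &
      c = @LocalParam (T * T')%type (mdim M + mdim N)
            [set w | pdom a (lsubmx w) /\ pdom b (rsubmx w)]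
            (fun w => (pfun a (lsubmx w), pfun b (rsubmx w)))]].

(* S as a d-dimensional embedded submanifold of the finite-dimensional space  *)
(* E, with all diffeomorphisms from open sets of R^d to relatively open sets  *)
(* of S as parametrizations. That these cover S is the content of             *)
(* [is_manifold (submanifold S d)].                                           *)
Definition submanifold {E : normedModType R} (S : set E) (d : nat) :
    premanifold E :=
  @PreManifold E S d
    [set a | [/\ open (pdom a),
                 smooth_on (pdom a) (pfun a),
                 exists2 O : set E, open O & pfun a @` pdom a = S `&` O &
                 exists i : E -> 'rV[R]_d,
                   smooth_subset (pfun a @` pdom a) i /\
                   forall u, pdom a u -> i (pfun a u) = u]].

End Smooth.

Section Groups.
Context {T : Type}.
Implicit Types (G H : set T) (mul : T -> T -> T) (one : T) (inv : T -> T).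

Definition is_group G mul one inv : Prop :=
  [/\ G one,
      forall x y, G x -> G y -> G (mul x y),
      forall x, G x -> G (inv x),
      forall x y z, G x -> G y -> G z -> mul x (mul y z) = mul (mul x y) z &
      forall x, G x -> [/\ mul one x = x, mul x one = x,
                          mul (inv x) x = one & mul x (inv x) = one]].

Definition is_subgroup G mul one inv H : Prop :=
  [/\ H `<=` G, H one, forall x y, H x -> H y -> H (mul x y) &
      forall x, H x -> H (inv x)].

Definition fixed_points G (sigma : T -> T) : set T :=
  [set g | G g /\ sigma g = g].

Definition left_translate mul (g : T) (A : set T) : set T :=
  [set mul g h | h in A].

Definition left_cosets G mul H : set (set T) :=
  [set left_translate mul g H | g in G].

Definition is_action {U : Type} G mul one (X : set U) (act : T -> U -> U) :=
  [/\ forall g x, G g -> X x -> X (act g x),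
      forall x, X x -> act one x = x &
      forall g h x, G g -> G h -> X x -> act (mul g h) x = act g (act h x)].

Definition transitive_action {U : Type} G (X : set U) (act : T -> U -> U) :=
  X !=set0 /\ forall x y, X x -> X y -> exists2 g, G g & act g x = y.

Definition twisted_conj mul inv (sigma : T -> T) (g h : T) : T :=
  mul (mul g h) (sigma (inv g)).

End Groups.

Section LieGroups.
Context {R : realType}.

Definition is_lie_group {T : Type} (G : @premanifold R T)
    (mul : T -> T -> T) (one : T) (inv : T -> T) : Prop :=
  [/\ is_manifold G,
      is_group (mpoints G) mul one inv,
      smooth_map (prod_manifold G G) G setT (fun x => mul x.1 x.2) &
      smooth_map G G setT inv].

Definition is_smooth_action {T U : Type} (G : @premanifold R T)
    (mul : T -> T -> T) (one : T) (X : @premanifold R U)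
    (act : T -> U -> U) : Prop :=
  is_action (mpoints G) mul one (mpoints X) act /\
  smooth_map (prod_manifold G X) X setT (fun x => act x.1 x.2).

(* Here G is an embedded submanifold of E, so that its topology is the        *)
(* subspace topology.                                                         *)
Record affine_symmetric_space {E : normedModType R} (G : set E) (d : nat)
    (mul : E -> E -> E) (one : E) (inv : E -> E) (H : set E)
    (sigma : E -> E) : Prop := AffineSymmetricSpace {
  ass_lie_group : is_lie_group (submanifold G d) mul one inv;
  ass_connected : connected G;
  ass_smooth : smooth_map (submanifold G d) (submanifold G d) setT sigma;
  ass_morphism : forall x y, G x -> G y ->
    sigma (mul x y) = mul (sigma x) (sigma y);
  ass_involutive : forall x, G x -> sigma (sigma x) = x;
  ass_subgroup : is_subgroup G mul one inv H;
  ass_closed : exists2 C : set E, closed C & H = G `&` C;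
  ass_fixed : H `<=` fixed_points G sigma;
  ass_component : connected_component (fixed_points G sigma) one `<=` H }.

(* The smooth structure of G/H is the unique one for which the projection is  *)
(* smooth and has smooth local sections.                                      *)
Definition is_quotient_manifold {T : Type} (G : @premanifold R T)
    (mul : T -> T -> T) (H : set T) (Q : @premanifold R (set T)) : Prop :=
  [/\ is_manifold Q,
      mpoints Q = left_cosets (mpoints G) mul H,
      smooth_map G Q setT (fun g => left_translate mul g H) &
      forall x, mpoints Q x -> exists (W : set (set T)) (s : set T -> T),
        [/\ mopen Q W, W x, smooth_map Q G W s &
            forall y, W y -> left_translate mul (s y) H = y]].

End LieGroups.

Section Euclidean.
Context {R : realType}.
Local Notation aff n := ('M[R]_n * 'cV[R]_n)%type.

Definition dot {n : nat} (u v : 'cV[R]_n) : R := (u^T *m v) 0 0.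

Definition in_O {n : nat} (A : 'M[R]_n) : Prop := A *m A^T = 1%:M.
Definition in_SO {n : nat} (A : 'M[R]_n) : Prop := in_O A /\ \det A = 1.

Definition SE (n : nat) : set (aff n) := [set g | in_SO g.1].
Arguments SE n : clear implicits.

Definition se_mul {n : nat} (g h : aff n) : aff n :=
  (g.1 *m h.1, g.2 + g.1 *m h.2).
Definition se_one {n : nat} : aff n := (1%:M, 0).
Definition se_inv {n : nat} (g : aff n) : aff n :=
  (invmx g.1, - (invmx g.1 *m g.2)).
Definition se_dim (n : nat) : nat := 'C(n, 2) + n.
Definition SE_manifold (n : nat) : premanifold (aff n) :=
  submanifold (SE n) (se_dim n).

Definition mx_image {m n : nat} (A : 'M[R]_(m, n)) (pi : {vspace 'cV[R]_n}) :
    {vspace 'cV[R]_m} :=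
  (linfun (mulmx A : 'cV[R]_n -> 'cV[R]_m) @: pi)%VS.

(* The orthogonal projection of X: the unique Y in pi with X - Y normal to    *)
(* pi (the default value 0 is never reached).                                 *)
Definition pr {n : nat} (pi : {vspace 'cV[R]_n}) (X : 'cV[R]_n) : 'cV[R]_n :=
  xget 0 [set Y | Y \in pi /\ forall Z, Z \in pi -> dot (X - Y) Z = 0].

Definition star {n : nat} (g : aff n) (x : {vspace 'cV[R]_n} * 'cV[R]_n) :
    {vspace 'cV[R]_n} * 'cV[R]_n :=
  (mx_image g.1 x.1, g.1 *m x.2 + 2 *: pr (mx_image g.1 x.1) g.2).

Section PQ.
Variables p q : nat.
Local Notation n := (p + q)%N.

Definition Jpq : 'M[R]_n := block_mx (- 1%:M) 0 0 1%:M.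

Definition sigma (g : aff n) : aff n := (Jpq *m g.1 *m Jpq, Jpq *m g.2).

Definition se_bullet (g h : aff n) : aff n :=
  twisted_conj se_mul se_inv sigma g h.

Definition Sp : set (aff n) := [set se_bullet g se_one | g in SE n].

Definition SOpOq_Rq : set (aff n) :=
  [set g | exists (A : 'M[R]_p) (B : 'M[R]_q) (X : 'cV[R]_q),
    [/\ in_O A, in_O B, \det A * \det B = 1 &
        g = (block_mx A 0 0 B, col_mx 0 X)]].

Definition Grassmannian : set {vspace 'cV[R]_n} := [set pi | \dim pi = p].

Definition Cnp : set ({vspace 'cV[R]_n} * 'cV[R]_n) :=
  [set x | Grassmannian x.1 /\ x.2 \in x.1].

(* A frame of the plane with coordinates M in the affine chart of G(n,p)      *)
(* that is attached to the p coordinate axes selected by s.                   *)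
Definition graph_frame (s : 'S_n) (M : 'M[R]_(q, p)) : 'M[R]_(n, p) :=
  perm_mx s *m col_mx 1%:M M.

Definition bundle_dim : nat := q * p + p.

(* The trivialization of the canonical bundle over this affine chart, by      *)
(* coordinates M of the base point and z of a fibre vector in the frame.      *)
Definition bundle_param (s : 'S_n) :
    local_param (R := R) ({vspace 'cV[R]_n} * 'cV[R]_n) bundle_dim :=
  LocalParam setT (fun w : 'rV[R]_bundle_dim =>
    let B := graph_frame s (vec_mx (lsubmx w)) in
    (mx_image B fullv, B *m (rsubmx w)^T)).

Definition C_manifold :
    @premanifold R ({vspace 'cV[R]_n} * 'cV[R]_n) :=
  PreManifold Cnp (range bundle_param).

Definition Sp_manifold : premanifold (aff n) := submanifold Sp bundle_dim.

Definition rho (x : aff n) : {vspace 'cV[R]_n} * 'cV[R]_n :=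
  (passmx.leigenspace
     (linfun (mulmx (x.1 *m Jpq) : 'cV[R]_n -> 'cV[R]_n)) (-1), x.2).

End PQ.
End Euclidean.

Arguments SE R n : clear implicits.
Arguments SE_manifold R n : clear implicits.
Arguments Sp R p q : clear implicits.
Arguments Sp_manifold R p q : clear implicits.
Arguments SOpOq_Rq R p q : clear implicits.
Arguments Cnp R p q : clear implicits.
Arguments C_manifold R p q : clear implicits.

(* Main.v *)
Require Import Defs.
From HB Require Import structures.
From mathcomp Require Import all_boot all_order all_algebra all_fingroup.
From mathcomp Require Import all_classical all_reals all_analysis.
From mathcomp Require Import ring.

(** A pair (pi, Y) of the bundle is encoded by the matrix pair
    kappa (pi, Y) = ((1 - 2 P) J, Y), where P is the matrix of the orthogonal
    projection onto pi and J is Jpq.  Since 1 - 2 P is the reflection that is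
    -1 on pi and 1 on its normal space, pi is recovered as the (-1)-eigenspace
    of (1 - 2 P) J J, so rho (kappa x) = x (rho_kappa).  The projection onto
    A pi is A P A^T, and because J is its own inverse the twisted conjugation
    g . kappa (pi, Y) is ((1 - 2 A P A^T) J, A Y + 2 A P A^T X), which is
    kappa of g * (pi, Y) (kappa_star).  Hence kappa carries the action * on
    the bundle to the twisted conjugation, and S_p, the orbit of the identity
    = kappa (base_pt), is the image of the bundle as soon as * is transitive
    (Sp_kappa).  So rho and kappa are inverse equivariant bijections, and in
    the ambient matrix space both are the identity.

    Smoothness is always reduced to maps between ambient matrix spaces.  A
    manifold M is called embedded by a map e into a finite-dimensional normed
    space when each parametrization composed with e is smooth and has a local
    smooth left inverse defined on an open set of the ambient space
    (embedded).  Then a map is smooth if it is locally the restriction of a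
    smooth ambient map (embedded_smooth_map), and the manifold axioms reduce
    to a countable cover (embedded_manifold).  In these terms the action is
    polynomial: the inverse of an orthogonal matrix is its transpose.

    The charts of SE(n) are D cayley(S) with S skew-symmetric and D a diagonal
    matrix of signs.  They cover because every A admits signs D with D + A
    invertible: the alternating sum of det (D + A) over all D is 2^n
    (sign_shift_unit).  SE(n) is connected because cayley (t S) joins
    cayley S to 1, and because flipping two signs is the square of the Cayley
    transform of a quarter turn (cayley_sqr), so that D is joined to 1 two
    signs at a time (linked_sign).

    Over the chart of the Grassmannian formed by the graphs of M, the columns
    of (1, M) span the plane and those of (-M^T, 1) span its normal space.
    The Gram-Schmidt process applied to both yields a rotation that depends
    smoothly on M, and with the translation Y / 2 a smooth section of the
    orbit map g |-> g * base_pt (bundle_secP, smooth_bundle_sec).  This gives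
    transitivity and makes the orbit map a submersion with local sections.
    The stabilizer of base_pt is the fixed point group of sigma, since
    g * base_pt = base_pt means g sigma(g)^-1 = 1 (stabilizer_base).  The
    cosets of this group are therefore the fibres of the orbit map; local
    sections on both sides identify the bundle with any quotient manifold
    (coset_point_diffeomorphism).  The vectors of the bundle are unbounded,
    so the quotient is not compact (quotient_not_compact). *)

Set Implicit Arguments.
Unset Strict Implicit.
Unset Printing Implicit Defensive.

Import Order.TTheory GRing.Theory Num.Theory.
Import numFieldNormedType.Exports.

Local Open Scope classical_set_scope.
Local Open Scope ring_scope.

(** * Calculus of C^k functions *)

Section Calculus.
Context {R : realType}.
Implicit Types U V W : normedModType R.

Lemma Ck_cont k V W (U : set V) (f : V -> W) x :
  Ck k U f -> U x -> {for x, continuous f}.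
Proof.
case: k => [|k] /= H Ux; first exact: H.
by apply: differentiable_continuous; apply: H.1.
Qed.

Lemma CkW k V W (U : set V) (f : V -> W) : Ck k.+1 U f -> Ck k U f.
Proof.
elim: k f => [|k IH] f [df Df]; first by move=> x /df /differentiable_continuous.
by split=> // v; apply: IH; exact: Df.
Qed.

Lemma Ck_sub k V W (U U' : set V) (f : V -> W) :
  U' `<=` U -> Ck k U f -> Ck k U' f.
Proof.
move=> sub; elim: k f => [|k IH] f /=; first by move=> H x /sub; apply: H.
by move=> [df Df]; split=> [x /sub /df //|v]; apply: IH.
Qed.

(** Differentiability is a condition on the germ: the o-estimate at the point
    only involves the values near it. *)
Lemma near_eq_differentiable V W (f g : V -> W) x :
  (\forall y \near x, f y = g y) -> differentiable f x -> differentiable g x.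
Proof.
move=> fg df; have fgx : f x = g x := nbhs_singleton fg.
have [cdf] := (diff_locallyP x f).1 df.
move=> /eqaddoP dfE.
have dgE : g \o shift x = cst (g x) + 'd f x +o_ 0 id.
  apply/eqaddoP => e e0; have := dfE e e0.
  have : \forall y \near 0, f (y + x) = g (y + x).
    by move: fg; rewrite (near_shift 0) subr0; apply: filterS.
  by apply: filterS2 => y /= E; rewrite !fctE /= E fgx.
apply/diff_locallyP; have -> : 'd g x = 'd f x :> (V -> W) by apply: diff_unique.
by split.
Qed.

Lemma Ck_eq k V W (U : set V) (f g : V -> W) : open U ->
  (forall x, U x -> f x = g x) -> Ck k U f -> Ck k U g.
Proof.
move=> oU; elim: k f g => [|k IH] f g fg.
  move=> cf x Ux; have nfg : \forall y \near x, f y = g y.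
    by have := open_nbhs_nbhs (conj oU Ux); apply: filterS => y; exact: fg.
  rewrite /prop_for /continuous_at -(fg _ Ux).
  by apply: cvg_trans (cf x Ux); apply: near_eq_cvg.
have nfg x : U x -> \forall y \near x, f y = g y.
  by move=> Ux; have := open_nbhs_nbhs (conj oU Ux); apply: filterS => y; exact: fg.
move=> [df Df]; split=> [x Ux|v].
  exact: near_eq_differentiable (nfg _ Ux) (df _ Ux).
by apply: (IH _ _ _ (Df v)) => x Ux; apply: near_eq_derive; exact: nfg.
Qed.

Lemma Ck_cst k V W (U : set V) (c : W) : Ck k U (fun=> c).
Proof.
elim: k c => [|k IH] c /=; first by move=> x _; exact: cst_continuous.
split=> [x _|v]; first exact: differentiable_cst.
have -> : (fun x => 'D_v (fun=> c) x) = fun=> 0 :> W; last exact: IH.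
by apply/funext => x; rewrite derive_cst.
Qed.

Lemma CkD k V W (U : set V) (f g : V -> W) : open U ->
  Ck k U f -> Ck k U g -> Ck k U (fun x => f x + g x).
Proof.
move=> oU; elim: k f g => [|k IH] f g.
  by move=> cf cg x Ux; apply: continuousD; [exact: cf|exact: cg].
move=> [df Df] [dg Dg]; split=> [x Ux|v].
  exact: differentiableD (df _ Ux) (dg _ Ux).
apply: (Ck_eq oU _ (IH _ _ (Df v) (Dg v))) => x Ux.
by rewrite -deriveD//; apply: diff_derivable; auto.
Qed.

(** Leibniz rule, D_v (B f g) = B f (D_v g) + B (D_v f) g, so that one order
    of smoothness of f and g is consumed at each step of the induction. *)
Lemma Ck_bilin k V W W' W'' (U : set V) (B : {bilinear W -> W' -> W''})
    (f : V -> W) (g : V -> W') : continuous (fun p => B p.1 p.2) -> open U ->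
  Ck k U f -> Ck k U g -> Ck k U (fun x => B (f x) (g x)).
Proof.
move=> cB oU; elim: k f g => [|k IH] f g.
  move=> cf cg x Ux; pose h x := (f x, g x).
  apply: (continuous_comp (f := h) (g := fun p => B p.1 p.2)); last exact: cB.
  by apply: cvg_pair; [exact: cf|exact: cg].
move=> Cf Cg; have [df Df] := Cf; have [dg Dg] := Cg.
have dfg x : U x -> is_diff x (fun x => B (f x) (g x))
    (fun v => B (f x) ('d g x v) + B ('d f x v) (g x)).
  move=> Ux; have dp := differentiable_pair (df _ Ux) (dg _ Ux).
  split; first exact: differentiable_comp dp (differentiable_bilin _ cB).
  rewrite [LHS](diff_comp dp (differentiable_bilin _ cB)).
  rewrite diff_bilin// diff_pair//; [exact: df|exact: dg].
split=> [x /dfg[]//|v].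
apply: (@Ck_eq _ _ _ _ (fun x => B (f x) ('D_v g x) + B ('D_v f x) (g x))) => //.
  move=> x Ux; have [dfgx E] := dfg x Ux; rewrite [RHS]deriveE// E.
  by rewrite (deriveE _ (df _ Ux)) (deriveE _ (dg _ Ux)).
by apply: CkD => //; apply: IH; [exact: CkW|exact: Dg|exact: Df|exact: CkW].
Qed.

Lemma scale_bilinear W : bilinear_for
  (GRing.Scale.Law.clone _ _ *:%R _) (GRing.Scale.Law.clone _ _ *:%R _)
  (fun (a : R) (x : W) => a *: x).
Proof.
split=> [u'|u] a x y /=.
- by rewrite scalerDl scalerA.
- by rewrite scalerDr !scalerA mulrC.
Qed.

Lemma CkZ k V W (U : set V) (f : V -> R) (g : V -> W) : open U ->
  Ck k U f -> Ck k U g -> Ck k U (fun x => f x *: g x).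
Proof.
move=> oU Cf Cg; pose s (a : R) (x : W) := a *: x.
pose sM := bilinear_isBilinear.Build R R W W _ _ s (scale_bilinear W).
pose B : {bilinear R -> W -> W} := HB.pack s sM.
by apply: (Ck_bilin (B := B)) => //; exact: scale_continuous.
Qed.

Lemma Ck_lin k V W W' (U : set V) (L : {linear W -> W'}) (f : V -> W) :
  continuous L -> Ck k U f -> open U -> Ck k U (fun x => L (f x)).
Proof.
move=> cL + oU; elim: k f => [|k IH] f.
  by move=> cf x Ux; apply: continuous_comp; [exact: cf|exact: cL].
move=> [df Df]; have dL y : is_diff y L L.
  by split; [exact: linear_differentiable|exact: diff_lin].
have dLf x : U x -> is_diff x (L \o f) (L \o 'd f x).
  by move=> Ux; apply: is_diff_comp; exact: differentiableP (df _ Ux).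
split=> [x /dLf[]//|v]; apply: (Ck_eq oU _ (IH _ (Df v))) => x Ux.
have [dLfx E] := dLf x Ux.
by rewrite (deriveE _ dLfx) E (deriveE _ (df _ Ux)).
Qed.

(** The derivative - (1 / f) (1 / f) D_v f is built from 1 / f and D_v f, to
    which the induction hypothesis applies. *)
Lemma CkV k V (U : set V) (f : V -> R) : open U ->
  (forall x, U x -> f x != 0) -> Ck k U f -> Ck k U (fun x => (f x)^-1).
Proof.
move=> oU f0; elim: k => [|k IH].
  by move=> cf x Ux; apply: continuousV; [exact: f0|exact: (cf x Ux)].
move=> Cf; have [df Df] := Cf; split=> [x Ux|v].
  by apply: differentiableV; [exact: df|exact: f0].
apply: (@Ck_eq _ _ _ _
  (fun x => (- 1 : R) *: ((f x)^-1 *: ((f x)^-1 *: 'D_v f x)))) => //.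
  move=> x Ux; rewrite [RHS]deriveE; last first.
    by apply: differentiableV; [exact: df|exact: f0].
  rewrite diffV; [|exact: df|exact: f0]; rewrite (deriveE _ (df _ Ux)).
  by rewrite !scalerA /= !mulN1r -invfM.
have CV := IH (CkW Cf).
apply: (CkZ (f := fun=> -1)) => //; first exact: Ck_cst.
apply: (CkZ (f := fun x => (f x)^-1)) => //.
by apply: (CkZ (f := fun x => (f x)^-1)) => //; exact: Df.
Qed.

(** The derivative D_v f / (2 sqrt f) involves sqrt f only at one order less. *)
Lemma Ck_sqrt k V (U : set V) (f : V -> R) : open U ->
  (forall x, U x -> 0 < f x) -> Ck k U f -> Ck k U (fun x => Num.sqrt (f x)).
Proof.
move=> oU f0; elim: k => [|k IH].
  move=> cf x Ux; apply: (continuous_comp (g := Num.sqrt)); first exact: cf.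
  exact: sqrt_continuous.
move=> Cf; have [df Df] := Cf.
have dsqrt x : U x -> is_diff x (fun x => Num.sqrt (f x))
    (fun v => (2 * Num.sqrt (f x))^-1 *: 'd f x v).
  move=> Ux; have [der E] := is_derive1_sqrt (f0 _ Ux).
  have ds := (derivable1_diffP _ _).1 der.
  split; first exact: differentiable_comp (df _ Ux) ds.
  rewrite [LHS](diff_comp (df _ Ux) ds); apply/funext => v /=.
  by rewrite diff1E//= derive1E E; exact: mulrC.
split=> [x /dsqrt[]//|v].
apply: (@Ck_eq _ _ _ _ (fun x => ((2 : R) *: Num.sqrt (f x))^-1 *: 'D_v f x)) => //.
  move=> x Ux; have [ds E] := dsqrt x Ux.
  by rewrite [RHS]deriveE// E (deriveE _ (df _ Ux)).
have Cs := IH (CkW Cf).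
apply: CkZ => //; last exact: Df.
apply: CkV => //; last by apply: CkZ => //; exact: Ck_cst.
by move=> x Ux; rewrite mulf_neq0// gt_eqF// sqrtr_gt0; exact: f0.
Qed.

End Calculus.

(** * Finite-dimensional spaces and the chain rule *)

Section FiniteDimension.
Context {R : realType}.
Implicit Types U V W : normedModType R.

(** A basis with its coordinate forms.  Continuity of the forms is part of
    the data, which makes all linear maps on V continuous. *)
Definition findim V : Prop := exists (I : finType) (e : I -> V)
    (c : I -> {linear V -> R}),
  (forall i, continuous (c i)) /\ forall v, v = \sum_i c i v *: e i.

Lemma Ck_sum (I : Type) (r : seq I) (P : pred I) k V W (U : set V)
    (F : I -> V -> W) : open U -> (forall i, P i -> Ck k U (F i)) ->
  Ck k U (fun x => \sum_(i <- r | P i) F i x).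
Proof.
move=> oU CF; elim: r => [|i r IH].
  by under eq_fun do rewrite big_nil; exact: Ck_cst.
under eq_fun do rewrite big_cons.
by case Pi: (P i) => //; apply: CkD => //; exact: CF.
Qed.

Lemma sum_continuous (I : Type) (r : seq I) V W (F : I -> V -> W) :
  (forall i, continuous (F i)) -> continuous (fun x => \sum_(i <- r) F i x).
Proof.
move=> cF; have := @Ck_sum I r xpredT 0 V W setT F openT.
by move=> H x; apply: H => // i _ y _; exact: cF.
Qed.

Lemma findim_linear_continuous V W (L : {linear V -> W}) :
  findim V -> continuous L.
Proof.
move=> [I [e [c [cc E]]]].
have -> : (L : V -> W) = fun v => \sum_i c i v *: L (e i).
  apply/funext => v; transitivity (L (\sum_i c i v *: e i)); first by rewrite -E.
  by rewrite linear_sum; apply: eq_bigr => i _; rewrite linearZ.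
by apply: sum_continuous => i x; apply: continuousZr_tmp; exact: cc.
Qed.

(** The derivative 'd g (f x) ('D_v f x) is in a direction that varies with x,
    while the definition of C^k only speaks of derivatives in fixed
    directions.  Expanding 'D_v f x in a basis of V turns it into a
    combination of derivatives of g in fixed directions, composed with f. *)
Lemma Ck_comp k V' V W (O : set V') (Q : set V) (f : V' -> V) (g : V -> W) :
  findim V -> open O -> open Q -> (forall x, O x -> Q (f x)) ->
  Ck k O f -> Ck k Q g -> Ck k O (fun x => g (f x)).
Proof.
move=> fV oO oQ OQ; elim: k g => [|k IH] g Cf Cg.
  by move=> x Ox; apply: continuous_comp; [exact: Cf|apply: Cg; exact: OQ].
have [df Df] := Cf; have [dg Dg] := Cg.
have dgf x : O x -> is_diff x (fun x => g (f x)) ('d g (f x) \o 'd f x).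
  move=> Ox; have dgfx := dg _ (OQ _ Ox).
  by split; [exact: differentiable_comp (df _ Ox) _|rewrite diff_comp//; exact: df].
split=> [x /dgf[]//|v]; have [I [e [c [cc E]]]] := fV.
apply: (@Ck_eq _ _ _ _ _
  (fun x => \sum_i c i ('D_v f x) *: 'D_(e i) g (f x))) => //.
  move=> x Ox; have [d1 d2] := dgf _ Ox; rewrite [RHS]deriveE// d2 /=.
  rewrite -(deriveE _ (df _ Ox)) [in RHS](E ('D_v f x)) linear_sum.
  by apply: eq_bigr => i _; rewrite linearZ/= (deriveE _ (dg _ (OQ _ Ox))).
apply: Ck_sum => // i _; apply: CkZ => //; first by apply: Ck_lin => //; exact: Df.
by apply: (IH ('D_(e i) g)) => //; [exact: CkW|exact: Dg].
Qed.

Lemma findim_R : findim R.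
Proof.
exists unit, (fun=> 1), (fun=> idfun); split=> [i x|v]; first exact: cvg_id.
by rewrite big_const card_unit /= addr0 /GRing.scale /= mulr1.
Qed.

Lemma mx_coord_linear m n (i : 'I_m) (j : 'I_n) :
  linear (fun M : 'M[R]_(m, n) => M i j).
Proof. by move=> a A B; rewrite !mxE. Qed.

Lemma findim_mx m n : findim 'M[R]_(m, n).
Proof.
pose c (ij : 'I_m * 'I_n) : {linear 'M[R]_(m, n) -> R} :=
  HB.pack (fun M : 'M[R]_(m, n) => M ij.1 ij.2)
    (GRing.isLinear.Build _ _ _ _ _ (@mx_coord_linear m n ij.1 ij.2)).
exists ('I_m * 'I_n)%type, (fun ij => delta_mx ij.1 ij.2), c.
split=> [ij|v]; first exact: coord_continuous.
by rewrite [LHS]matrix_sum_delta pair_big.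
Qed.

Lemma findim_prod V V' : findim V -> findim V' -> findim (V * V')%type.
Proof.
move=> [I [e [c [cc E]]]] [I' [e' [c' [cc' E']]]].
have l1 i : linear (fun p : V * V' => c i p.1) by move=> a x y; rewrite linearP.
have l2 i : linear (fun p : V * V' => c' i p.2) by move=> a x y; rewrite linearP.
pose C (i : I + I') : {linear (V * V')%type -> R} := match i with
  | inl i => HB.pack (fun p : V * V' => c i p.1)
      (GRing.isLinear.Build _ _ _ _ _ (l1 i))
  | inr i => HB.pack (fun p : V * V' => c' i p.2)
      (GRing.isLinear.Build _ _ _ _ _ (l2 i))
  end.
exists (I + I')%type,
  (fun i => match i with inl i => (e i, 0) | inr i => (0, e' i) end), C.
split=> [[i|i] x|[v v']] /=.
- by apply: (continuous_comp (f := fst)); [exact: cvg_fst|exact: cc].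
- by apply: (continuous_comp (f := snd)); [exact: cvg_snd|exact: cc'].
rewrite big_sumType /=; have -> : \sum_i c i v *: (e i, 0 : V') = (v, 0).
  rewrite [in RHS](E v); elim/big_ind2: _ => [//|x1 x2 y1 y2 -> ->|i _].
    by congr pair; rewrite addr0.
  by congr pair; rewrite scaler0.
have -> : \sum_i c' i v' *: (0 : V, e' i) = (0, v').
  rewrite [in RHS](E' v'); elim/big_ind2: _ => [//|x1 x2 y1 y2 -> ->|i _].
    by congr pair; rewrite addr0.
  by congr pair; rewrite scaler0.
by congr pair; rewrite ?addr0 ?add0r.
Qed.

End FiniteDimension.

(** * Smooth matrix-valued functions *)

Section SmoothAlgebra.
Context {R : realType}.
Implicit Types V W : normedModType R.

Lemma smooth_cont V W (U : set V) (f : V -> W) x :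
  smooth_on U f -> U x -> {for x, continuous f}.
Proof. by move=> /(_ 0%N); exact: Ck_cont. Qed.

Lemma smooth_sub V W (U U' : set V) (f : V -> W) :
  U' `<=` U -> smooth_on U f -> smooth_on U' f.
Proof. by move=> sub sf k; exact: Ck_sub (sf k). Qed.

Lemma smooth_eq V W (U : set V) (f g : V -> W) : open U ->
  (forall x, U x -> f x = g x) -> smooth_on U f -> smooth_on U g.
Proof. by move=> oU fg sf k; exact: Ck_eq (sf k). Qed.

Lemma smooth_cst V W (U : set V) (c : W) : smooth_on U (fun=> c).
Proof. by move=> k; exact: Ck_cst. Qed.

Lemma smooth_linear V W (U : set V) (L : V -> W) :
  findim V -> open U -> linear L -> smooth_on U L.
Proof.
move=> fV oU lL; pose lM := GRing.isLinear.Build _ _ _ _ _ lL.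
pose l : {linear V -> W} := HB.pack L lM.
have cl : continuous l by exact: findim_linear_continuous.
suff Ck_l k : Ck k U l by move=> k; exact: Ck_l.
elim: k => [x _|k IH]; first exact: cl.
split=> [x _|v]; first exact: linear_differentiable.
apply: (@Ck_eq _ _ _ _ _ (fun=> l v)) => //; last exact: Ck_cst.
by move=> x Ux; rewrite deriveE ?diff_lin//; exact: linear_differentiable.
Qed.

Lemma smooth_comp V' V W (O : set V') (Q : set V) (f : V' -> V) (g : V -> W) :
  findim V -> open O -> open Q -> (forall x, O x -> Q (f x)) ->
  smooth_on O f -> smooth_on Q g -> smooth_on O (fun x => g (f x)).
Proof. by move=> fV oO oQ OQ sf sg k; exact: (Ck_comp _ _ _ OQ (sf k) (sg k)). Qed.

Lemma smooth_lin V W W' (U : set V) (L : W -> W') (f : V -> W) :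
  findim W -> open U -> linear L -> smooth_on U f -> smooth_on U (fun x => L (f x)).
Proof.
move=> fW oU lL sf; apply: (smooth_comp (Q := setT)) => //; first exact: openT.
by apply: smooth_linear => //; exact: openT.
Qed.

Context {V : normedModType R} {U : set V} (oU : open U).

Lemma smoothD W (f g : V -> W) :
  smooth_on U f -> smooth_on U g -> smooth_on U (fun x => f x + g x).
Proof. by move=> sf sg k; exact: CkD. Qed.

Lemma smoothZ W (f : V -> R) (g : V -> W) :
  smooth_on U f -> smooth_on U g -> smooth_on U (fun x => f x *: g x).
Proof. by move=> sf sg k; exact: CkZ. Qed.

Lemma smoothZl W (a : R) (g : V -> W) :
  smooth_on U g -> smooth_on U (fun x => a *: g x).
Proof. by apply: (smoothZ (f := fun=> a)); exact: smooth_cst. Qed.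

Lemma smoothN W (f : V -> W) : smooth_on U f -> smooth_on U (fun x => - f x).
Proof. by move=> sf; under eq_fun do rewrite -scaleN1r; exact: smoothZl. Qed.

Lemma smoothB W (f g : V -> W) :
  smooth_on U f -> smooth_on U g -> smooth_on U (fun x => f x - g x).
Proof. by move=> sf sg; apply: smoothD => //; exact: smoothN. Qed.

Lemma smooth_sum (I : Type) (r : seq I) (P : pred I) W (F : I -> V -> W) :
  (forall i, P i -> smooth_on U (F i)) ->
  smooth_on U (fun x => \sum_(i <- r | P i) F i x).
Proof. by move=> sF k; apply: Ck_sum => // i Pi; exact: sF. Qed.

Lemma smoothM (f g : V -> R) :
  smooth_on U f -> smooth_on U g -> smooth_on U (fun x => f x * g x).
Proof. by move=> sf sg; exact: (smoothZ (W := R) sf sg). Qed.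

Lemma smooth_prod (I : Type) (r : seq I) (P : pred I) (F : I -> V -> R) :
  (forall i, P i -> smooth_on U (F i)) ->
  smooth_on U (fun x => \prod_(i <- r | P i) F i x).
Proof.
move=> sF; elim: r => [|i r IH].
  by under eq_fun do rewrite big_nil; exact: smooth_cst.
under eq_fun do rewrite big_cons.
by case Pi: (P i) => //; apply: smoothM => //; exact: sF.
Qed.

Lemma smoothV (f : V -> R) :
  (forall x, U x -> f x != 0) -> smooth_on U f -> smooth_on U (fun x => (f x)^-1).
Proof. by move=> f0 sf k; exact: CkV. Qed.

Lemma smooth_sqrt (f : V -> R) :
  (forall x, U x -> 0 < f x) -> smooth_on U f ->
  smooth_on U (fun x => Num.sqrt (f x)).
Proof. by move=> f0 sf k; exact: Ck_sqrt. Qed.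

Lemma smooth_pair W W' (f : V -> W) (g : V -> W') :
  findim W -> findim W' ->
  smooth_on U f -> smooth_on U g -> smooth_on U (fun x => (f x, g x)).
Proof.
move=> fW fW' sf sg.
apply: (@smooth_eq _ _ _ (fun x => (f x, 0) + (0, g x))) => //.
  by move=> x _; rewrite [LHS]surjective_pairing /= addr0 add0r.
have l1 : linear (fun y : W => (y, 0 : W')).
  by move=> a x y; rewrite [RHS]surjective_pairing /= scaler0 addr0.
have l2 : linear (fun y : W' => (0 : W, y)).
  by move=> a x y; rewrite [RHS]surjective_pairing /= scaler0 addr0.
by apply: smoothD; [exact: smooth_lin l1 sf|exact: smooth_lin l2 sg].
Qed.

Lemma smooth_entry m n (f : V -> 'M[R]_(m, n)) i j :
  smooth_on U f -> smooth_on U (fun x => f x i j).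
Proof.
apply: (smooth_lin (L := fun M : 'M[R]_(m, n) => M i j)) => //.
  exact: findim_mx.
exact: mx_coord_linear.
Qed.

Lemma smooth_mx m n (f : V -> 'M[R]_(m, n)) :
  (forall i j, smooth_on U (fun x => f x i j)) -> smooth_on U f.
Proof.
move=> sf; apply: (@smooth_eq _ _ _
  (fun x => \sum_i \sum_j f x i j *: delta_mx i j)) => //.
  by move=> x _; rewrite [RHS]matrix_sum_delta.
apply: smooth_sum => i _; apply: smooth_sum => j _.
by apply: smoothZ => //; exact: smooth_cst.
Qed.

Lemma smooth_mulmx m n p (f : V -> 'M[R]_(m, n)) (g : V -> 'M[R]_(n, p)) :
  smooth_on U f -> smooth_on U g -> smooth_on U (fun x => f x *m g x).
Proof.
move=> sf sg; apply: smooth_mx => i j; under eq_fun do rewrite mxE.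
by apply: smooth_sum => k _; apply: smoothM; exact: smooth_entry.
Qed.

Lemma smooth_trmx m n (f : V -> 'M[R]_(m, n)) :
  smooth_on U f -> smooth_on U (fun x => (f x)^T).
Proof.
move=> sf; apply: smooth_mx => i j; under eq_fun do rewrite mxE.
exact: smooth_entry.
Qed.

Lemma smooth_usubmx m n p (f : V -> 'M[R]_(m + p, n)) :
  smooth_on U f -> smooth_on U (fun x => usubmx (f x)).
Proof.
move=> sf; apply: smooth_mx => i j; under eq_fun do rewrite mxE.
exact: smooth_entry.
Qed.

Lemma smooth_dsubmx m n p (f : V -> 'M[R]_(m + p, n)) :
  smooth_on U f -> smooth_on U (fun x => dsubmx (f x)).
Proof.
move=> sf; apply: smooth_mx => i j; under eq_fun do rewrite mxE.
exact: smooth_entry.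
Qed.

Lemma smooth_lsubmx m n p (f : V -> 'M[R]_(n, m + p)) :
  smooth_on U f -> smooth_on U (fun x => lsubmx (f x)).
Proof.
move=> sf; apply: smooth_mx => i j; under eq_fun do rewrite mxE.
exact: smooth_entry.
Qed.

Lemma smooth_rsubmx m n p (f : V -> 'M[R]_(n, m + p)) :
  smooth_on U f -> smooth_on U (fun x => rsubmx (f x)).
Proof.
move=> sf; apply: smooth_mx => i j; under eq_fun do rewrite mxE.
exact: smooth_entry.
Qed.

Lemma smooth_row_mx m n p (f : V -> 'M[R]_(m, n)) (g : V -> 'M[R]_(m, p)) :
  smooth_on U f -> smooth_on U g -> smooth_on U (fun x => row_mx (f x) (g x)).
Proof.
move=> sf sg; apply: smooth_mx => i j; under eq_fun do rewrite mxE.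
by case: (fintype.split j) => k; exact: smooth_entry.
Qed.

Lemma smooth_col_mx m n p (f : V -> 'M[R]_(n, m)) (g : V -> 'M[R]_(p, m)) :
  smooth_on U f -> smooth_on U g -> smooth_on U (fun x => col_mx (f x) (g x)).
Proof.
move=> sf sg; apply: smooth_mx => i j; under eq_fun do rewrite mxE.
by case: (fintype.split i) => k; exact: smooth_entry.
Qed.

Lemma smooth_vec_mx m n (f : V -> 'rV[R]_(m * n)) :
  smooth_on U f -> smooth_on U (fun x => vec_mx (f x)).
Proof.
move=> sf; apply: smooth_mx => i j; under eq_fun do rewrite mxE.
exact: smooth_entry.
Qed.

Lemma smooth_mxvec m n (f : V -> 'M[R]_(m, n)) :
  smooth_on U f -> smooth_on U (fun x => mxvec (f x)).
Proof.
move=> sf; apply: (smooth_lin (L := mxvec)) => //; first exact: findim_mx.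
exact: linearP.
Qed.

Lemma smooth_det n (f : V -> 'M[R]_n) :
  smooth_on U f -> smooth_on U (fun x => \det (f x)).
Proof.
move=> sf; rewrite /determinant; apply: smooth_sum => s _.
apply: smoothM; first exact: smooth_cst.
by apply: smooth_prod => i _; exact: smooth_entry.
Qed.

(** Cramer's rule: the entries of the inverse are cofactors divided by the
    determinant. *)
Lemma smooth_invmx n (f : V -> 'M[R]_n) :
  (forall x, U x -> f x \in unitmx) ->
  smooth_on U f -> smooth_on U (fun x => invmx (f x)).
Proof.
move=> fu sf.
apply: (@smooth_eq _ _ _ (fun x => (\det (f x))^-1 *: \adj (f x))) => //.
  by move=> x Ux; rewrite /invmx fu.
apply: smoothZ; first apply: smoothV.
- by move=> x /fu; rewrite unitmxE unitfE.
- exact: smooth_det.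
apply: smooth_mx => i j; under eq_fun do rewrite mxE /cofactor.
apply: smoothM; first exact: smooth_cst.
apply: smooth_det; rewrite /row' /col'.
apply: smooth_mx => a b; under eq_fun do rewrite !mxE.
exact: smooth_entry.
Qed.

End SmoothAlgebra.

(** * Manifolds embedded in a normed space *)

Section Embeddings.
Context {R : realType}.
Local Notation mparams M := (@mparam _ _ M).

Lemma open_preimage_in (V W : normedModType R) (U : set V) (Q : set W)
    (f : V -> W) : open U -> (forall x, U x -> {for x, continuous f}) ->
  open Q -> open (U `&` f @^-1` Q).
Proof.
move=> oU cf oQ; rewrite openE => x [Ux Qx]; apply: filterI.
  exact: open_nbhs_nbhs.
by apply: (cf x Ux); exact: open_nbhs_nbhs.
Qed.

(** The local inverse g lives on an open set of the ambient space, and not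
    only on the image of M: it can then be composed with ambient maps without
    any further choice of extensions. *)
Definition embedded {T : Type} (M : @premanifold R T) {E : normedModType R}
    (e : T -> E) : Prop :=
  findim E /\ forall a, mparams M a ->
    [/\ open (pdom a), forall u, pdom a u -> mpoints M (pfun a u),
        smooth_on (pdom a) (fun u => e (pfun a u)) &
        forall u, pdom a u -> exists (O : set E) (g : E -> 'rV[R]_(mdim M)),
          [/\ open O, O (e (pfun a u)), smooth_on O g,
              forall x, mpoints M x -> O (e x) ->
                pdom a (g (e x)) /\ pfun a (g (e x)) = x &
              forall w, pdom a w -> O (e (pfun a w)) ->
                g (e (pfun a w)) = w]].

Lemma embedded_mopen {T} (M : @premanifold R T) {E : normedModType R}
    (e : T -> E) (O : set E) : embedded M e -> open O ->
  mopen M (mpoints M `&` e @^-1` O).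
Proof.
move=> [_ eM] oO; split=> [x []//|a /eM[oa aM sa _]].
suff -> : pdom a `&` [set u | (mpoints M `&` e @^-1` O) (pfun a u)] =
    pdom a `&` (fun u => e (pfun a u)) @^-1` O.
  by apply: open_preimage_in => // x; exact: smooth_cont.
by apply/seteqP; split=> [u [au []]|u [au Ou]]; do ?split=> //; exact: aM.
Qed.

(** Read in charts, f is the local inverse of the target chart after F after
    e after the source chart. *)
Lemma embedded_smooth_map {T T'} (M : @premanifold R T)
    (N : @premanifold R T') {E E' : normedModType R} (e : T -> E) (e' : T' -> E')
    (W : set T) (f : T -> T') : embedded M e -> embedded N e' ->
  (forall x, mpoints M x -> W x -> exists (O : set E) (F : E -> E'),
    [/\ open O, O (e x), smooth_on O F &
        forall y, mpoints M y -> O (e y) ->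
          mpoints N (f y) /\ e' (f y) = F (e y)]) ->
  smooth_map M N W f.
Proof.
move=> [fE eM] [fE' eN] H; split.
  by move=> x Mx Wx; have [ O [F [_ Ox _ /(_ x Mx Ox)[]]]] := H _ Mx Wx.
move=> a b u v Ma Nb au bv Wu fuv.
have [oa aM sa _] := eM _ Ma; have [ob bN sb] := eN _ Nb.
move=> /(_ v bv)[Q [g [oQ Qv sg gN gK]]].
have [ O [F [oO Ou sF fF]]] := H _ (aM _ au) Wu.
pose ea u := e (pfun a u).
have oO1 : open (pdom a `&` ea @^-1` O).
  by apply: open_preimage_in => // x; exact: smooth_cont.
have sFe : smooth_on (pdom a `&` ea @^-1` O) (fun u => F (ea u)).
  apply: (smooth_comp (Q := O)) => //; first by move=> x [].
  by apply: smooth_sub sa => x [].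
pose O2 := (pdom a `&` ea @^-1` O) `&` (fun u => F (ea u)) @^-1` Q.
have oO2 : open O2 by apply: open_preimage_in => // x; exact: smooth_cont.
exists O2, (fun w => g (F (ea w))); split=> //.
- split; first by split.
  by have [_ E1] := fF _ (aM _ au) Ou; rewrite /= /ea -E1 fuv.
- by move=> x [[]].
- apply: (smooth_comp (Q := Q)) => //; first by move=> x [].
  by apply: smooth_sub sFe => x [].
move=> w [[aw Ow] Qw]; have [Nw Ew] := fF _ (aM _ aw) Ow.
by rewrite /ea -Ew; have [] := gN _ Nw; rewrite ?Ew.
Qed.

(** Two points with the same image lie in the domain of the same local
    inverse, which recovers both. *)
Lemma embedded_inj {T} (M : @premanifold R T) {E : normedModType R}
    (e : T -> E) x y : embedded M e -> covers (mparams M) (mpoints M) ->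
  mpoints M x -> mpoints M y -> e x = e y -> x = y.
Proof.
move=> [_ eM] cM Mx My exy; have [a Ma [u au uE]] := cM _ Mx.
have [_ _ _ /(_ u au)[ O [g [_ Ox _ gM _]]]] := eM _ Ma.
rewrite uE in Ox; have [_ <-] := gM _ Mx Ox; rewrite exy in Ox *.
by have [_ ->] := gM _ My Ox.
Qed.

(** Compatibility of charts is the smoothness of the identity, and disjoint
    neighbourhoods are preimages of disjoint ambient ones. *)
Lemma embedded_manifold {T} (M : @premanifold R T) {E : normedModType R}
    (e : T -> E) (A : set (local_param T (mdim M))) : embedded M e ->
  countable A -> A `<=` mparams M -> covers A (mpoints M) -> is_manifold M.
Proof.
move=> eM cA AM covA.
have covM : covers (mparams M) (mpoints M).
  by move=> x /covA[a /AM Ma aP]; exists a.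
split=> //.
- move=> a Ma; have [oa aM sa loc] := eM.2 _ Ma; split=> // u u' au au' uu'.
  have [ O [g [_ Ou _ _ gK]]] := loc _ au.
  by rewrite -(gK _ au Ou) uu' gK// -uu'.
- apply: (embedded_smooth_map eM eM) => x Mx _.
  exists setT, id; split=> //; first exact: openT.
  apply: smooth_linear => //; [exact: eM.1|exact: openT].
- move=> x y Mx My xy.
  have exy : e x != e y by apply/eqP => /(embedded_inj eM covM Mx My).
  have /= := @norm_hausdorff _ E; rewrite open_hausdorff.
  move=> /(_ _ _ exy)[[ O O'] /= [/set_mem xO /set_mem yO'] [oO oO' /eqP OO']].
  exists (mpoints M `&` e @^-1` O), (mpoints M `&` e @^-1` O').
  split; [exact: embedded_mopen|exact: embedded_mopen|by []|by []|].
  by rewrite setIACA -preimage_setI OO' preimage_set0 setI0.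
- by exists A.
Qed.

Lemma embedded_prod {T T'} (M : @premanifold R T)
    (N : @premanifold R T') {E E' : normedModType R} (e : T -> E) (e' : T' -> E') :
  embedded M e -> embedded N e' ->
  embedded (prod_manifold M N) (fun x => (e x.1, e' x.2)).
Proof.
move=> [fE eM] [fE' eN]; split; first exact: findim_prod.
move=> c [a [b [Ma Nb ->]]] /=.
have [oa aM sa aL] := eM _ Ma; have [ob bN sb bL] := eN _ Nb.
have fR k : findim 'rV[R]_k by exact: findim_mx.
have sl : smooth_on setT (fun w : 'rV[R]_(mdim M + mdim N) => lsubmx w).
  by apply: smooth_linear; [exact: fR|exact: openT|exact: linearP].
have sr : smooth_on setT (fun w : 'rV[R]_(mdim M + mdim N) => rsubmx w).
  by apply: smooth_linear; [exact: fR|exact: openT|exact: linearP].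
have oab : open [set w : 'rV[R]_(mdim M + mdim N) |
    pdom a (lsubmx w) /\ pdom b (rsubmx w)].
  have oa' := open_preimage_in openT (fun x => @smooth_cont _ _ _ _ _ x sl) oa.
  have ob' := open_preimage_in openT (fun x => @smooth_cont _ _ _ _ _ x sr) ob.
  by have := openI oa' ob'; rewrite !setTI.
split=> //.
- by move=> w [aw bw]; split; [exact: aM|exact: bN].
- apply: smooth_pair => //.
    apply: (smooth_comp (f := fun w => lsubmx w) (Q := pdom a)
      (g := fun u => e (pfun a u)) (fR _) oab oa _ _ sa); first by move=> x [].
    exact: smooth_sub sl.
  apply: (smooth_comp (f := fun w => rsubmx w) (Q := pdom b)
    (g := fun u => e' (pfun b u)) (fR _) oab ob _ _ sb); first by move=> x [].
  exact: smooth_sub sr.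
move=> w [aw bw]; have [ O [g [oO Ow sg gM gK]]] := aL _ aw.
have [ O' [g' [oO' Ow' sg' gM' gK']]] := bL _ bw.
have fEE := findim_prod fE fE'.
have oOO : open (O `*` O') by apply: (openI (A := fst @^-1` O) (B := snd @^-1` O'));
    apply: open_comp => // x _; [exact: cvg_fst|exact: cvg_snd].
exists (O `*` O'), (fun z => row_mx (g z.1) (g' z.2)); split=> //.
- apply: smooth_row_mx => //.
    apply: (smooth_comp (Q := O)) => //; first by move=> x [].
    exact: smooth_linear.
  apply: (smooth_comp (Q := O')) => //; first by move=> x [].
  exact: smooth_linear.
- move=> [x x'] [/= Mx Mx'] [/= Ox Ox']; rewrite row_mxKl row_mxKr.
  have [? ->] := gM _ Mx Ox; have [? ->] := gM' _ Mx' Ox'.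
  by split.
- by move=> z [az bz] [/= Oz Oz']; rewrite gK// gK'// hsubmxK.
Qed.

Lemma embedded_submanifold {E : normedModType R} (S : set E) d :
  findim E -> embedded (submanifold S d) id.
Proof.
move=> fE; split=> // a [oa sa [ O oO aO] [i [si iK]]]; split=> //.
  move=> u au; have : (pfun a @` pdom a) (pfun a u) by exists u.
  by rewrite aO => -[].
move=> u au; have aau : (pfun a @` pdom a) (pfun a u) by exists u.
have [ O' [g [oO' O'u sg gi]]] := si _ aau.
have [_ Ou] : (S `&` O) (pfun a u) by rewrite -aO.
exists (O `&` O'), g; split=> //.
- exact: openI.
- by apply: smooth_sub sg => x [].
- move=> x Sx [Ox O'x]; have ax : (pfun a @` pdom a) x by rewrite aO.
  by rewrite /= gi//; case: ax => w aw <-; rewrite iK.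
- by move=> w aw [Ow O'w]; rewrite gi ?iK//; exists w.
Qed.

Lemma smooth_map_ambient {T T'} (M : @premanifold R T)
    (N : @premanifold R T') (E E' : normedModType R) (e : T -> E) (e' : T' -> E')
    (f : T -> T') (F : E -> E') : embedded M e -> embedded N e' ->
  smooth_on setT F ->
  (forall y, mpoints M y -> mpoints N (f y) /\ e' (f y) = F (e y)) ->
  smooth_map M N setT f.
Proof.
move=> eM eN sF fF; apply: (embedded_smooth_map eM eN) => x Mx _.
by exists setT, F; split=> //; [exact: openT|move=> y My _; exact: fF].
Qed.

End Embeddings.

(** * Composition and locality of smooth maps *)

Section SmoothMaps.
Context {R : realType}.
Local Notation mparams M := (@mparam _ _ M).

(** The chart of N through the intermediate point is read at the value that
    the first local representative takes there. *)
Lemma smooth_map_comp {T T' T''} (M : @premanifold R T) (N : @premanifold R T')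
    (P : @premanifold R T'') (W : set T) (f : T -> T') (g : T' -> T'') :
  is_manifold M -> is_manifold N ->
  smooth_map M N W f -> smooth_map N P setT g ->
  smooth_map M P W (fun x => g (f x)).
Proof.
move=> mM mN [fN sf] [gP sg]; split=> [x Mx Wx|a b u v Ma Pb au bv Wu guv].
  by apply: gP => //; exact: fN.
have [oa aM _] := param_ok mM Ma.
have [c Nc [w cw cE]] := param_cover mN (fN _ (aM _ au) Wu).
have [ O1 [h1 [oO1 O1u O1a sh1 h1P]]] := sf a c u w Ma Nc au cw Wu (esym cE).
have [ch1 fh1] := h1P _ O1u.
have guv' : g (pfun c (h1 u)) = pfun b v by rewrite -fh1.
have [ O2 [h2 [oO2 O2u O2a sh2 h2P]]] := sg c b _ v Nc Pb ch1 bv I guv'.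
have oO : open (O1 `&` h1 @^-1` O2).
  by apply: open_preimage_in => // x; exact: smooth_cont.
exists (O1 `&` h1 @^-1` O2), (fun w => h2 (h1 w)); split=> //.
- by move=> x [/O1a].
- apply: (smooth_comp (Q := O2)) => //; [exact: findim_mx|by move=> x []|].
  by apply: smooth_sub sh1 => x [].
by move=> x [ O1x O2x]; have [_ ->] := h1P _ O1x; exact: h2P.
Qed.

Lemma smooth_map_local {T T'} (M : @premanifold R T) (N : @premanifold R T')
    (f : T -> T') : is_manifold M ->
  (forall x, mpoints M x -> exists (W : set T) (f' : T -> T'),
    [/\ mopen M W, W x, smooth_map M N W f' & forall y, W y -> f' y = f y]) ->
  smooth_map M N setT f.
Proof.
move=> mM H; split=> [x Mx _|a b u v Ma Nb au bv _ fuv].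
  by have [W [f' [_ Wx [fN _] fE]]] := H x Mx; rewrite -fE//; exact: fN.
have [oa aM _] := param_ok mM Ma.
have [W [f' [oW Wu [_ sf'] f'E]]] := H _ (aM _ au).
have f'uv : f' (pfun a u) = pfun b v by rewrite f'E.
have [ O1 [h [oO O1u O1a sh hP]]] := sf' a b u v Ma Nb au bv Wu f'uv.
have oW' := oW.2 _ Ma.
exists (O1 `&` (pdom a `&` [set u | W (pfun a u)])), h; split=> //.
- exact: (openI oO oW').
- by move=> x [_ []].
- by apply: smooth_sub sh => x [].
by move=> w [ O1w [aw Ww]]; have [bh <-] := hP _ O1w; rewrite f'E.
Qed.

Lemma smooth_map_mopen {T T'} (M : @premanifold R T) (N : @premanifold R T')
    (f : T -> T') (O : set T') : is_manifold M -> is_manifold N ->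
  smooth_map M N setT f -> mopen N O -> mopen M (mpoints M `&` f @^-1` O).
Proof.
move=> mM mN [fN sf] [_ oO]; split=> [x []//|a Ma].
have [oa aM _] := param_ok mM Ma.
rewrite openE => u [au [Mu Ou]].
have [b Nb [v bv bE]] := param_cover mN (fN _ Mu I).
have [ O1 [h [oO1 O1u O1a sh hP]]] := sf a b u v Ma Nb au bv I (esym bE).
have := open_preimage_in oO1 (fun x => @smooth_cont _ _ _ _ _ x sh) (oO b Nb).
move=> oO2; have : nbhs u (O1 `&` h @^-1` (pdom b `&` [set u | O (pfun b u)])).
  apply: open_nbhs_nbhs; split=> //; split=> //; have [bh E] := hP _ O1u.
  by split=> //=; rewrite -E.
apply: filterS => w [ O1w [bw Ow]]; split; first exact: O1a.
by split; [exact/aM/O1a|rewrite /preimage /= (hP _ O1w).2].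
Qed.

End SmoothMaps.

(** * Orthogonal projections and frames of subspaces *)

Section Projections.
Context {R : realType}.

Lemma mulmx_cV_inj m n (A B : 'M[R]_(m, n)) :
  (forall v : 'cV_n, A *m v = B *m v) -> A = B.
Proof.
move=> AB; apply/matrixP => i j.
have := AB (delta_mx j 0); rewrite -!colE => /colP/(_ i).
by rewrite !mxE.
Qed.

Lemma dot_eq0 n (u : 'cV[R]_n) : dot u u = 0 -> u = 0.
Proof.
rewrite /dot mxE => /eqP; rewrite psumr_eq0; last first.
  by move=> i _; rewrite mxE -expr2 sqr_ge0.
move=> /allP u0; apply/colP => i; rewrite mxE.
by have := u0 i (mem_index_enum i); rewrite mxE -expr2 /= expf_eq0 => /eqP.
Qed.

Lemma mem_mx_image m n (A : 'M[R]_(m, n)) (pi : {vspace 'cV[R]_n}) v :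
  reflect (exists2 u, u \in pi & v = A *m u) (v \in mx_image A pi).
Proof.
apply: (iffP memv_imgP) => -[u upi ->]; exists u => //.
  by rewrite lfunE.
by rewrite lfunE.
Qed.

Lemma mem_mx_span m n (A : 'M[R]_(m, n)) v :
  reflect (exists u, v = A *m u) (v \in mx_image A fullv).
Proof.
apply: (iffP (mem_mx_image _ _ _)) => [[u _ ->]|[u ->]]; first by exists u.
by exists u => //; exact: memvf.
Qed.

Lemma mx_imageM m n k (A : 'M[R]_(m, n)) (B : 'M[R]_(n, k)) pi :
  mx_image (A *m B) pi = mx_image A (mx_image B pi).
Proof.
apply/vspaceP => v; apply/mem_mx_image/mem_mx_image => [[u upi ->]|[u]].
  by exists (B *m u); [apply/mem_mx_image; exists u|rewrite mulmxA].
by move=> /mem_mx_image[w wpi ->] ->; exists w; rewrite ?mulmxA.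
Qed.

Definition mx_inj m n (B : 'M[R]_(m, n)) : Prop :=
  forall v : 'cV_n, B *m v = 0 -> v = 0.

Lemma dim_mx_image m n (A : 'M[R]_(m, n)) (pi : {vspace 'cV[R]_n}) :
  mx_inj A -> \dim (mx_image A pi) = \dim pi.
Proof.
move=> A0; apply: limg_dim_eq; apply/eqP; rewrite -subv0.
apply/subvP => v; rewrite memv_cap memv_ker lfunE => /andP[_ /eqP/A0 ->].
exact: mem0v.
Qed.

Lemma dim_frame m n (A : 'M[R]_(m, n)) :
  mx_inj A -> \dim (mx_image A fullv) = n.
Proof. by move=> /dim_mx_image ->; rewrite dimvf; exact: muln1. Qed.

Lemma subspace_frame n p (pi : {vspace 'cV[R]_n}) : \dim pi = p ->
  exists2 B : 'M[R]_(n, p), mx_inj B & pi = mx_image B fullv.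
Proof.
move=> <-; pose B := \matrix_(i < n, j < \dim pi) ((vbasis pi)`_j) i 0.
have BE (z : 'cV_(\dim pi)) : B *m z = \sum_j z j 0 *: (vbasis pi)`_j.
  apply/colP => i; rewrite mxE summxE; apply: eq_bigr => j _.
  by rewrite !mxE mulrC.
exists B.
  move=> z; rewrite BE => z0; have /freeP/(_ _ z0) H := basis_free (vbasisP pi).
  by apply/colP => j; rewrite H mxE.
apply/vspaceP => v; apply/idP/mem_mx_span => [vpi|[z ->]].
  exists (\col_j coord (vbasis pi) j v); rewrite BE [LHS](coord_vbasis vpi).
  by apply: eq_bigr => j _; rewrite mxE.
rewrite BE; apply: memv_suml => j _; apply: memvZ.
by apply: vbasis_mem; apply: mem_nth; rewrite size_tuple.
Qed.

(** P is the matrix of the orthogonal projection onto pi: symmetric,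
    idempotent, with pi as its space of fixed vectors. *)
Definition is_proj n (P : 'M[R]_n) (pi : {vspace 'cV[R]_n}) : Prop :=
  [/\ P^T = P, P *m P = P & forall v, (v \in pi) = (P *m v == v)].

(** Each projection fixes the range of the other, so Q P = P and P Q = Q;
    transposing the first gives P = P Q. *)
Lemma is_proj_uniq n (P Q : 'M[R]_n) pi : is_proj P pi -> is_proj Q pi -> P = Q.
Proof.
have half (A B : 'M[R]_n) : is_proj A pi -> is_proj B pi -> A *m B = B.
  move=> [_ _ Am] [_ BB Bm]; apply: mulmx_cV_inj => v; rewrite -mulmxA.
  by apply/eqP; rewrite -Am Bm mulmxA BB.
move=> pP pQ; have [PT _ _] := pP; have [QT _ _] := pQ.
by rewrite -[LHS]PT -[X in X^T](half _ _ pQ pP) trmx_mul PT QT (half _ _ pP pQ).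
Qed.

Lemma dotE n (u v : 'cV[R]_n) : dot u v = (u^T *m v) 0 0.
Proof. by []. Qed.

Lemma pr_is_proj n (P : 'M[R]_n) pi X : is_proj P pi -> pr pi X = P *m X.
Proof.
move=> [PT PP Pm]; have PXpi : P *m X \in pi by rewrite Pm mulmxA PP.
have nP Z : Z \in pi -> dot (X - P *m X) Z = 0.
  rewrite Pm => /eqP ZE; rewrite dotE linearB /= trmx_mul PT mulmxBl -mulmxA ZE.
  by rewrite subrr mxE.
apply: xget_unique => [//|Y [Ypi nY]].
apply/eqP; rewrite -subr_eq0; apply/eqP; apply: dot_eq0.
have Dpi : Y - P *m X \in pi by apply: rpredB.
set D := Y - P *m X in Dpi *.
have -> : dot D D = dot (X - P *m X) D - dot (X - Y) D.
  rewrite !dotE; transitivity (((X - P *m X)^T *m D - (X - Y)^T *m D) 0 0).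
    rewrite -mulmxBl -linearB /=; congr ((_^T *m _) 0 0).
    by rewrite opprB addrC addrA subrK.
  by rewrite mxE [X in _ + X]mxE.
by rewrite nP// nY// subrr.
Qed.

Lemma is_proj_image n (A P : 'M[R]_n) pi : in_O A -> is_proj P pi ->
  is_proj (A *m P *m A^T) (mx_image A pi).
Proof.
move=> AO [PT PP Pm]; have AO' : A^T *m A = 1%:M by exact: mulmx1C.
split=> [| |v].
- by rewrite !trmx_mul trmxK PT mulmxA.
- by rewrite -!mulmxA (mulmxA A^T) AO' mul1mx (mulmxA P) PP.
apply/mem_mx_image/eqP => [[u]|E].
  by rewrite Pm => /eqP uE ->; rewrite -!mulmxA (mulmxA A^T) AO' mul1mx uE.
exists (P *m A^T *m v); last by rewrite !mulmxA.
by rewrite Pm !mulmxA PP.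
Qed.

Definition gram m n (B : 'M[R]_(m, n)) := B^T *m B.
(** The projection onto the span of the columns of B, by the normal
    equations. *)
Definition frame_proj m n (B : 'M[R]_(m, n)) := B *m invmx (gram B) *m B^T.

(** If G v = 0 for the Gram matrix G, then B v has norm 0. *)
Lemma gram_unit m n (B : 'M[R]_(m, n)) :
  mx_inj B -> gram B \in unitmx.
Proof.
move=> B0; rewrite -row_free_unit; apply: inj_row_free => v vG.
apply: trmx_inj; rewrite trmx0; apply: B0; apply: dot_eq0.
by rewrite dotE trmx_mul trmxK mulmxA -(mulmxA v) vG mul0mx mxE.
Qed.

Lemma frame_is_proj m n (B : 'M[R]_(m, n)) :
  mx_inj B ->
  is_proj (frame_proj B) (mx_image B fullv).
Proof.
move=> /gram_unit uG.
have GT : (gram B)^T = gram B by rewrite trmx_mul trmxK.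
have PB : frame_proj B *m B = B by rewrite -!mulmxA mulVmx// mulmx1.
split=> [| |v].
- by rewrite !trmx_mul trmxK trmx_inv GT mulmxA.
- by rewrite {2}/frame_proj !mulmxA PB.
apply/mem_mx_span/eqP => [[u ->]|E]; first by rewrite mulmxA PB.
by exists (invmx (gram B) *m B^T *m v); rewrite !mulmxA.
Qed.

Lemma is_proj_exists n (pi : {vspace 'cV[R]_n}) : exists P, is_proj P pi.
Proof.
have [B B0 ->] := subspace_frame (erefl (\dim pi)).
by exists (frame_proj B); exact: frame_is_proj.
Qed.

Definition proj_mx_of n (pi : {vspace 'cV[R]_n}) : 'M[R]_n :=
  xget 0 [set P | is_proj P pi].

Lemma proj_mx_ofP n (pi : {vspace 'cV[R]_n}) : is_proj (proj_mx_of pi) pi.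
Proof. exact: (xgetPex 0 (is_proj_exists pi)). Qed.

Lemma proj_mx_of_eq n (P : 'M[R]_n) pi : is_proj P pi -> proj_mx_of pi = P.
Proof. exact: is_proj_uniq (proj_mx_ofP pi). Qed.

(** The complement of the range of f has q elements, and its enumeration
    provides the remaining values. *)
Lemma extend_injection p q (f : 'I_p -> 'I_(p + q)) : injective f ->
  exists s : 'S_(p + q), forall i, s (lshift q i) = f i.
Proof.
move=> fI; pose C := ~: [set f i | i in 'I_p].
have cC : q = #|C|.
  have := cardsC [set f i | i in 'I_p]; rewrite card_imset// !card_ord => /eqP.
  by rewrite eqn_add2l => /eqP.
pose g k := match fintype.split k with
  inl i => f i | inr j => enum_val (cast_ord cC j) end.
have gC j : enum_val (cast_ord cC j) \in C := enum_valP _.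
have gI : injective g.
  move=> k k'; rewrite -[k]splitK -[k']splitK /g !unsplitK.
  case: (fintype.split k) => i; case: (fintype.split k') => i' E.
  - by rewrite (fI _ _ E).
  - by have := gC i'; rewrite -E inE => /negP[]; exact: imset_f.
  - by have := gC i; rewrite E inE => /negP[]; exact: imset_f.
  - by have /cast_ord_inj -> := enum_val_inj E.
exists (perm gI) => i; rewrite permE /g.
by rewrite -[lshift q i]/(unsplit (inl i)) unsplitK.
Qed.

End Projections.

Section Frames.
Context {R : realType} (p q : nat).
Local Notation n := (p + q)%N.
Implicit Types (s : 'S_n) (M : 'M[R]_(q, p)).

Lemma perm_mxTK s : perm_mx s *m (perm_mx s)^T = 1%:M :> 'M[R]_n.
Proof. by rewrite tr_perm_mx -perm_mxM mulgV perm_mx1. Qed.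

Lemma perm_mxKT s : (perm_mx s)^T *m perm_mx s = 1%:M :> 'M[R]_n.
Proof. by rewrite tr_perm_mx -perm_mxM mulVg perm_mx1. Qed.

Lemma graph_frameK s M : usubmx ((perm_mx s)^T *m graph_frame s M) = 1%:M.
Proof. by rewrite mulmxA perm_mxKT mul1mx col_mxKu. Qed.

Lemma usubmxM m k l (A : 'M[R]_(m + k, l)) r (B : 'M[R]_(l, r)) :
  usubmx (A *m B) = usubmx A *m B.
Proof. by rewrite -{1}[A]vsubmxK mul_col_mx col_mxKu. Qed.

Lemma graph_frame_usub s M (z : 'cV_p) :
  usubmx ((perm_mx s)^T *m (graph_frame s M *m z)) = z.
Proof. by rewrite mulmxA usubmxM graph_frameK mul1mx. Qed.

Lemma graph_frame_inj s M : mx_inj (graph_frame s M).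
Proof.
move=> z E.
rewrite -(graph_frame_usub s M z) E mulmx0.
by apply/matrixP => i j; rewrite !mxE.
Qed.

(** Some p rows of a basis matrix of the plane form an invertible block B1.
    A permutation moves them to the top, and the change of basis by B1 turns
    the matrix into the frame of a graph. *)
Lemma graph_frame_exists (pi : {vspace 'cV[R]_n}) : \dim pi = p ->
  exists s M, pi = mx_image (graph_frame s M) fullv.
Proof.
move=> /subspace_frame[B B0 ->].
have fullB : row_full B.
  rewrite /row_full -mxrank_tr -/(row_free B^T); apply: inj_row_free => v vB.
  apply: trmx_inj; rewrite trmx0; apply: B0; apply: trmx_inj.
  by rewrite trmx_mul trmxK vB trmx0.
have [s sE] := extend_injection (@fullrankfun_inj _ _ _ _ fullB).
pose B1 := rowsub (fullrankfun fullB) B.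
have uB1 : B1 \in unitmx by exact: fullrowsub_unit.
pose B2 := dsubmx (perm_mx s *m B); exists s^-1%g, (B2 *m invmx B1).
have B1E : usubmx (perm_mx s *m B) = B1.
  by rewrite -row_permE; apply/matrixP => i j; rewrite !mxE sE.
have BE : B = graph_frame s^-1 (B2 *m invmx B1) *m B1.
  rewrite -mulmxA mul_col_mx mul1mx mulmxKV// -[B in LHS]mul1mx -perm_mx1.
  by rewrite -(mulVg s) perm_mxM -mulmxA -{1}[perm_mx s *m B]vsubmxK B1E.
rewrite [in LHS]BE mx_imageM; congr mx_image.
apply/vspaceP => v; rewrite memvf; apply/mem_mx_span.
by exists (invmx B1 *m v); rewrite mulKVmx.
Qed.

End Frames.

(** * The canonical bundle as an embedded manifold *)

Section Bundle.
Context {R : realType} (p q : nat).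
Local Notation n := (p + q)%N.
Local Notation aff := ('M[R]_n * 'cV[R]_n)%type.
Local Notation J := (@Jpq R p q).
Implicit Types (s : 'S_n).

Lemma Jpq_sqr : J *m J = 1%:M.
Proof.
rewrite /Jpq mulmx_block !(mulmx0, mul0mx, addr0, add0r) mulNmx mulmxN opprK.
by rewrite !mulmx1 -scalar_mx_block.
Qed.

Lemma Jpq_tr : J^T = J.
Proof. by rewrite /Jpq tr_block_mx !trmx0 linearN /= !trmx1. Qed.

(** The embedding of the bundle into the matrices.  Its image is the orbit of
    the identity under the twisted conjugation, and it is inverse to rho. *)
Definition kappa (x : {vspace 'cV[R]_n} * 'cV[R]_n) : aff :=
  ((1%:M - 2 *: proj_mx_of x.1) *m J, x.2).

Definition refl_proj (A : 'M[R]_n) : 'M[R]_n := 2^-1 *: (1%:M - A *m J).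

Lemma refl_projK (P : 'M[R]_n) : refl_proj ((1%:M - 2 *: P) *m J) = P.
Proof.
rewrite /refl_proj -mulmxA Jpq_sqr mulmx1 opprB addrC subrK scalerA.
by rewrite mulVf ?scale1r// pnatr_eq0.
Qed.

(** The projection written in the coordinates permuted by s.  For the graph of
    M it is (1, M) G (1, M)^T with G the inverse Gram matrix, so its upper left
    block is G and its lower left block is M G. *)
Definition chart_block s (y : aff) : 'M[R]_n :=
  (perm_mx s)^T *m refl_proj y.1 *m perm_mx s.

(** The ambient condition for the plane to be a graph over the p coordinate
    axes selected by s. *)
Definition chart_dom s : set aff :=
  [set y | \det (ulsubmx (chart_block s y)) != 0].

(** M is read off from the blocks G and M G, and the fibre coordinates are the
    first p entries of the vector, as the frame starts with the identity. *)
Definition chart_inv s (y : aff) : 'rV[R]_(bundle_dim p q) :=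
  row_mx (mxvec (dlsubmx (chart_block s y) *m invmx (ulsubmx (chart_block s y))))
    (usubmx ((perm_mx s)^T *m y.2))^T.

Lemma findim_aff m : findim ('M[R]_m * 'cV[R]_m)%type.
Proof. by apply: findim_prod; exact: findim_mx. Qed.

Lemma smooth_affine_fst m : smooth_on setT (fun y : 'M[R]_m * 'cV[R]_m => y.1).
Proof. by apply: smooth_linear => //; [exact: findim_aff|exact: openT]. Qed.

Lemma smooth_affine_snd m : smooth_on setT (fun y : 'M[R]_m * 'cV[R]_m => y.2).
Proof. by apply: smooth_linear => //; [exact: findim_aff|exact: openT]. Qed.

Lemma smooth_chart_block s : smooth_on setT (chart_block s).
Proof.
have oT := @openT aff.
apply: smooth_mulmx => //; last exact: smooth_cst.
apply: smooth_mulmx => //; first exact: smooth_cst.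
apply: smoothZl => //; apply: smoothB => //; first exact: smooth_cst.
by apply: smooth_mulmx => //; [exact: smooth_affine_fst|exact: smooth_cst].
Qed.

Lemma open_chart_dom s : open (chart_dom s).
Proof.
have oT := @openT aff.
have sd : smooth_on setT (fun y : aff => \det (ulsubmx (chart_block s y))).
  apply: smooth_det => //; apply: smooth_lsubmx => //; apply: smooth_usubmx => //.
  exact: smooth_chart_block.
have := open_preimage_in oT (fun x => @smooth_cont _ _ _ _ _ x sd) (@open_neq R^o 0).
by rewrite setTI.
Qed.

Lemma smooth_chart_inv s : smooth_on (chart_dom s) (chart_inv s).
Proof.
have oD := @open_chart_dom s.
have sb : smooth_on (chart_dom s) (chart_block s).
  exact: smooth_sub (@subsetT _ _) (@smooth_chart_block s).
apply: smooth_row_mx => //.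
  apply: smooth_mxvec => //; apply: smooth_mulmx => //.
    by apply: smooth_lsubmx => //; exact: smooth_dsubmx.
  apply: smooth_invmx => //; last first.
    by apply: smooth_lsubmx => //; exact: smooth_usubmx.
  by move=> y; rewrite unitmxE unitfE.
apply: smooth_trmx => //; apply: smooth_usubmx => //; apply: smooth_mulmx => //.
  exact: smooth_cst.
exact: smooth_sub (@subsetT _ _) (@smooth_affine_snd n).
Qed.

Lemma bundle_paramE s (w : 'rV[R]_(bundle_dim p q)) :
  let B := graph_frame s (vec_mx (lsubmx w)) in
  kappa (pfun (bundle_param s) w) =
    ((1%:M - 2 *: frame_proj B) *m J, B *m (rsubmx w)^T).
Proof.
rewrite /= /kappa /=; congr ((1%:M - 2 *: _) *m _, _).
by apply: proj_mx_of_eq; apply: frame_is_proj; exact: graph_frame_inj.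
Qed.

Lemma bundle_param_Cnp s (w : 'rV[R]_(bundle_dim p q)) :
  Cnp R p q (pfun (bundle_param s) w).
Proof.
split; first by apply: dim_frame; exact: graph_frame_inj.
by apply/mem_mx_span; exists (rsubmx w)^T.
Qed.

Lemma smooth_bundle_param s :
  smooth_on setT
    (fun w : 'rV[R]_(bundle_dim p q) => kappa (pfun (bundle_param s) w)).
Proof.
have oT := @openT 'rV[R]_(bundle_dim p q).
under eq_fun do rewrite bundle_paramE.
have sB : smooth_on setT (fun w : 'rV[R]_(bundle_dim p q) =>
    graph_frame s (vec_mx (lsubmx w))).
  apply: smooth_mulmx => //; first exact: smooth_cst.
  apply: smooth_col_mx => //; first exact: smooth_cst.
  apply: smooth_vec_mx => //; apply: smooth_linear => //; first exact: findim_mx.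
  exact: linearP.
have sw : smooth_on setT (fun w : 'rV[R]_(bundle_dim p q) => (rsubmx w)^T).
  apply: smooth_trmx => //; apply: smooth_linear => //; first exact: findim_mx.
  exact: linearP.
apply: smooth_pair => //; [exact: findim_mx|exact: findim_mx| |exact: smooth_mulmx].
apply: smooth_mulmx => //; last exact: smooth_cst.
apply: smoothB => //; first exact: smooth_cst.
apply: smoothZl => //; apply: smooth_mulmx => //; last exact: smooth_trmx.
apply: smooth_mulmx => //; apply: smooth_invmx => //.
  by move=> w _; apply: gram_unit; exact: graph_frame_inj.
by apply: smooth_mulmx => //; exact: smooth_trmx.
Qed.

Lemma chart_block_param s (w : 'rV[R]_(bundle_dim p q)) :
  let M := vec_mx (lsubmx w) in
  let G := invmx (gram (graph_frame s M)) in
  chart_block s (kappa (pfun (bundle_param s) w)) =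
    col_mx 1%:M M *m G *m (col_mx 1%:M M)^T.
Proof.
rewrite /= bundle_paramE /chart_block /= refl_projK /frame_proj.
set G := invmx _; rewrite trmx_mul !mulmxA perm_mxKT mul1mx -!mulmxA.
by rewrite perm_mxKT mulmx1.
Qed.

Lemma gram_graph_unit s M : invmx (gram (@graph_frame R p q s M)) \in unitmx.
Proof. by rewrite unitmx_inv; apply: gram_unit; exact: graph_frame_inj. Qed.

Lemma ul_mul3 (M : 'M[R]_(q, p)) (G : 'M[R]_p) :
  ulsubmx (col_mx 1%:M M *m G *m (col_mx 1%:M M)^T) = G /\
  dlsubmx (col_mx 1%:M M *m G *m (col_mx 1%:M M)^T) = M *m G.
Proof.
rewrite mul_col_mx mul1mx tr_col_mx mul_col_row trmx1 !mulmx1.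
by rewrite block_mxKul block_mxKdl.
Qed.

Lemma chart_dom_param s (w : 'rV[R]_(bundle_dim p q)) :
  chart_dom s (kappa (pfun (bundle_param s) w)).
Proof.
rewrite /chart_dom /= chart_block_param (ul_mul3 _ _).1.
by rewrite -unitfE -unitmxE gram_graph_unit.
Qed.

Lemma chart_invK s (w : 'rV[R]_(bundle_dim p q)) :
  chart_inv s (kappa (pfun (bundle_param s) w)) = w.
Proof.
rewrite /chart_inv chart_block_param (ul_mul3 _ _).1 (ul_mul3 _ _).2.
rewrite mulmxK ?gram_graph_unit// vec_mxK bundle_paramE /=.
by rewrite graph_frame_usub trmxK hsubmxK.
Qed.

(** If the upper left block of the projection is invertible, then its first p
    columns, normalized by this block, form a graph frame whose span lies in
    the plane; it is the whole plane because the dimensions agree. *)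
Lemma chart_paramK s x : Cnp R p q x -> chart_dom s (kappa x) ->
  pfun (bundle_param s) (chart_inv s (kappa x)) = x.
Proof.
case: x => pi Y [/= dpi Ypi] dom.
have pP := proj_mx_ofP pi; set P := proj_mx_of pi in pP.
have E : chart_block s (kappa (pi, Y)) = (perm_mx s)^T *m P *m perm_mx s.
  by rewrite /chart_block /= refl_projK.
rewrite /= /chart_inv row_mxKl row_mxKr mxvecK trmxK.
set N := chart_block _ _; set B := graph_frame s _.
have uN : ulsubmx N \in unitmx by rewrite unitmxE unitfE.
(* B consists of the first p columns of the permuted projection, normalized. *)
have BE : B = P *m (perm_mx s *m col_mx 1%:M 0 *m invmx (ulsubmx N)).
  have -> : B = perm_mx s *m (col_mx (ulsubmx N) (dlsubmx N) *m invmx (ulsubmx N)).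
    by rewrite mul_col_mx mulmxV.
  have -> : col_mx (ulsubmx N) (dlsubmx N) = N *m col_mx 1%:M 0.
    by rewrite -{3}[N]submxK mul_block_col !mulmx1 !mulmx0 !addr0.
  by rewrite /N E !mulmxA perm_mxTK mul1mx.
have piE : mx_image B fullv = pi.
  apply/eqP; rewrite eqEdim dim_frame ?dpi ?leqnn ?andbT; last exact: graph_frame_inj.
  apply/subvP => v /mem_mx_span[u ->]; have [_ PP ->] := pP.
  by rewrite BE !mulmxA PP.
congr pair => //; have : Y \in mx_image B fullv by rewrite piE.
by move=> /mem_mx_span[z ->]; rewrite graph_frame_usub.
Qed.

Lemma embedded_bundle : embedded (C_manifold R p q) kappa.
Proof.
split; first exact: findim_aff.
move=> _ [s _ <-]; split=> [|u _||u _] /=.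
- exact: openT.
- exact: bundle_param_Cnp.
- exact: smooth_bundle_param.
exists (chart_dom s), (chart_inv s); split.
- exact: open_chart_dom.
- exact: chart_dom_param.
- exact: smooth_chart_inv.
- by move=> x Cx dx; split=> //; exact: chart_paramK.
- by move=> w _ _; exact: chart_invK.
Qed.

Lemma covers_bundle : covers (range (@bundle_param R p q)) (Cnp R p q).
Proof.
move=> [pi Y] [/= dpi Ypi]; have [s [M piE]] := graph_frame_exists dpi.
exists (bundle_param s); first by exists s.
move: Ypi; rewrite piE => /mem_mx_span[z ->].
exists (row_mx (mxvec M) z^T) => //=.
by rewrite row_mxKl row_mxKr mxvecK trmxK.
Qed.

Lemma chart_dom_exists x : Cnp R p q x -> exists s, chart_dom s (kappa x).
Proof.
by move=> /covers_bundle[_ [s _ <-] [w _ <-]]; exists s; exact: chart_dom_param.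
Qed.

Lemma bundle_manifold : is_manifold (C_manifold R p q).
Proof.
apply: (embedded_manifold embedded_bundle _ _ covers_bundle) => //.
by apply: finite_set_countable; apply: finite_image; exact: finite_finset.
Qed.

End Bundle.

(** * Equivariance of the embedding *)

Section Equivariance.
Context {R : realType} (p q : nat).
Local Notation n := (p + q)%N.
Local Notation aff := ('M[R]_n * 'cV[R]_n)%type.
Local Notation J := (@Jpq R p q).
Implicit Types (g h : aff).

Lemma in_O_tr m (A : 'M[R]_m) : in_O A -> A^T *m A = 1%:M.
Proof. exact: mulmx1C. Qed.

Lemma in_O_unit m (A : 'M[R]_m) : in_O A -> A \in unitmx.
Proof. by case/mulmx1_unit. Qed.

Lemma in_O_inv m (A : 'M[R]_m) : in_O A -> invmx A = A^T.
Proof.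
by move=> AO; rewrite -[LHS]mulmx1 -AO mulKmx// in_O_unit.
Qed.

Definition base_frame : 'M[R]_(n, p) := col_mx 1%:M 0.
Definition base_plane : {vspace 'cV[R]_n} := mx_image base_frame fullv.
Definition base_proj : 'M[R]_n := block_mx 1%:M 0 0 0.
Definition base_pt : {vspace 'cV[R]_n} * 'cV[R]_n := (base_plane, 0).

Lemma base_frame_inj : mx_inj base_frame.
Proof.
move=> z; rewrite mul_col_mx mul1mx mul0mx -(col_mx0 R p q 1).
by move=> /eq_col_mx[].
Qed.

Lemma is_proj_base : is_proj base_proj base_plane.
Proof.
have G1 : gram base_frame = 1%:M.
  by rewrite /gram tr_col_mx mul_row_col trmx1 trmx0 mul1mx mul0mx addr0.
have <- : frame_proj base_frame = base_proj.
  rewrite /frame_proj G1 invmx1 mulmx1 tr_col_mx mul_col_row trmx1 trmx0.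
  by rewrite !mulmx1 !mulmx0.
by apply: frame_is_proj; exact: base_frame_inj.
Qed.

Lemma Jpq_proj : 1%:M - 2 *: base_proj = J.
Proof.
rewrite /base_proj /Jpq (scalar_mx_block p q 1) scale_block_mx !scaler0 opp_block_mx.
rewrite add_block_mx !oppr0 !addr0; congr block_mx.
by rewrite scaler_nat mulr2n opprD addrA subrr add0r.
Qed.

Lemma base_pt_Cnp : Cnp R p q base_pt.
Proof. by split=> /=; [apply: dim_frame; exact: base_frame_inj|exact: mem0v]. Qed.

Lemma kappa_base : kappa base_pt = se_one.
Proof.
by rewrite /kappa /= (proj_mx_of_eq is_proj_base) Jpq_proj Jpq_sqr.
Qed.

Lemma starE g pi Y P : in_O g.1 -> is_proj P pi ->
  star g (pi, Y) =
    (mx_image g.1 pi, g.1 *m Y + 2 *: (g.1 *m P *m g.1^T *m g.2)).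
Proof.
by move=> gO pP; rewrite /star /= (pr_is_proj _ (is_proj_image gO pP)).
Qed.

Lemma star_Cnp g x : in_O g.1 -> Cnp R p q x -> Cnp R p q (star g x).
Proof.
case: x => pi Y gO [/= dpi Ypi]; have pP := proj_mx_ofP pi.
rewrite (starE _ gO pP); split=> /=.
  rewrite /Grassmannian /= dim_mx_image// => v gv.
  by rewrite -[v]mul1mx -(in_O_tr gO) -mulmxA gv mulmx0.
apply: memvD; first by apply/mem_mx_image; exists Y.
apply: memvZ; apply/mem_mx_image; exists (proj_mx_of pi *m g.1^T *m g.2).
  by have [_ PP ->] := pP; rewrite !mulmxA PP.
by rewrite !mulmxA.
Qed.

(** The twisted conjugation with A^-1 replaced by A^T.  It agrees with the
    action for orthogonal A only, but it is polynomial on the whole ambient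
    space. *)
Definition bullet_poly (z : aff * aff) : aff :=
  (z.1.1 *m z.2.1 *m J *m z.1.1^T *m J,
   z.1.2 + z.1.1 *m z.2.2 - z.1.1 *m z.2.1 *m J *m z.1.1^T *m z.1.2).

Lemma se_bulletE g h : in_O g.1 -> se_bullet g h = bullet_poly (g, h).
Proof.
move=> gO; rewrite /se_bullet /twisted_conj /se_mul /sigma /se_inv /bullet_poly /=.
rewrite (in_O_inv gO) !mulmxA; congr pair.
by rewrite !mulmxN !mulmxA.
Qed.

(** As J^2 = 1, the factors J cancel in A (1 - 2 P) J J A^T, which leaves the
    reflection 1 - 2 A P A^T along the image plane. *)
Lemma kappa_star g x : in_O g.1 -> kappa (star g x) = se_bullet g (kappa x).
Proof.
case: x => pi Y gO; have pP := proj_mx_ofP pi.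
rewrite (starE _ gO pP) se_bulletE// /kappa /bullet_poly /=.
rewrite (proj_mx_of_eq (is_proj_image gO pP)); set P := proj_mx_of pi.
have E : g.1 *m ((1%:M - 2 *: P) *m J) *m J *m g.1^T =
    1%:M - 2 *: (g.1 *m P *m g.1^T).
  rewrite -!mulmxA (mulmxA J J) Jpq_sqr mul1mx mulmxBl mul1mx mulmxBr gO.
  by rewrite -scalemxAl -scalemxAr.
rewrite E; congr pair.
rewrite mulmxBl mul1mx -scalemxAl opprB (addrC g.2).
by rewrite -addrA (addrCA g.2) subrr addr0.
Qed.

(** The eigenvalue equation (1 - 2 P) v = - v means P v = v. *)
Lemma rho_kappa (x : {vspace 'cV[R]_n} * 'cV[R]_n) : rho (kappa x) = x.
Proof.
case: x => pi Y; rewrite /rho /kappa /=; congr pair.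
have [_ _ Pm] := proj_mx_ofP pi; apply/vspaceP => v.
rewrite Pm memv_ker !lfunE /= opp_lfunE scale_lfunE id_lfunE lfunE /=.
rewrite -(mulmxA _ J J) Jpq_sqr mulmx1 scaleN1r opprK mulmxBl mul1mx -scalemxAl.
set w := proj_mx_of pi *m v; rewrite addrAC -mulr2n -scaler_nat -scalerBr.
by rewrite scaler_eq0 pnatr_eq0 /= subr_eq0 eq_sym.
Qed.

Lemma star_action : Defs.is_action (SE R n) se_mul se_one (Cnp R p q) star.
Proof.
split.
- by move=> g x [gO _]; exact: star_Cnp.
- move=> [pi Y] _; have pP := proj_mx_ofP pi.
  rewrite (starE (g := se_one) Y _ pP) /=; last by rewrite /in_O trmx1 mulmx1.
  rewrite mul1mx mulmx0 scaler0 addr0; congr pair.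
  apply/vspaceP => v; apply/mem_mx_image/idP => [[u upi ->]|vpi].
    by rewrite mul1mx.
  by exists v; rewrite ?mul1mx.
- move=> g h [pi Y] [gO _] [hO _] _; have pP := proj_mx_ofP pi.
  have ghO : in_O (se_mul g h).1.
    by rewrite /in_O /= trmx_mul mulmxA -(mulmxA g.1) hO mulmx1.
  rewrite (starE _ ghO pP) (starE _ hO pP) (starE _ gO (is_proj_image hO pP)) /=.
  rewrite mx_imageM trmx_mul; congr pair; set P := proj_mx_of pi.
  rewrite !mulmxDr -!scalemxAr !mulmxA -addrA -scalerDr; congr (_ + 2 *: _).
  rewrite addrC -!mulmxA (mulmxA g.1^T) (in_O_tr gO) mul1mx.
  by rewrite !mulmxA.
Qed.

End Equivariance.

(** * The Gram-Schmidt process *)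

Section GramSchmidt.
Context {R : realType}.

(** The part of b that is orthogonal to the columns of Q, if these are
    orthonormal. *)
Definition gs_residue m k (b : 'cV[R]_m) (Q : 'M[R]_(m, k)) : 'cV[R]_m :=
  b - Q *m Q^T *m b.

Definition gs_normalize m (w : 'cV[R]_m) : 'cV[R]_m :=
  (Num.sqrt (dot w w))^-1 *: w.

(** The columns are processed from right to left, which makes the recursion
    structural in 1 + k. *)
Fixpoint gram_schmidt m k : 'M[R]_(m, k) -> 'M[R]_(m, k) :=
  match k with
  | 0%N => id
  | k'.+1 => fun B : 'M[R]_(m, 1 + k') =>
      let Q := gram_schmidt (rsubmx B) in
      row_mx (gs_normalize (gs_residue (lsubmx B) Q)) Q
  end.

Lemma dot_gt0 m (w : 'cV[R]_m) : w != 0 -> 0 < dot w w.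
Proof.
move=> w0; rewrite lt_neqAle eq_sym; apply/andP; split.
  by apply: contra w0 => /eqP/dot_eq0 ->.
by rewrite dotE mxE; apply: sumr_ge0 => i _; rewrite mxE -expr2 sqr_ge0.
Qed.

Lemma dot_normalize m (w : 'cV[R]_m) : w != 0 ->
  (gs_normalize w)^T *m gs_normalize w = 1%:M.
Proof.
move=> /dot_gt0 w0; rewrite /gs_normalize -scalemxAr [(_ *: w)^T]linearZ /=.
rewrite -scalemxAl scalerA.
apply/matrixP => i j; rewrite !ord1 mxE -/(dot w w) [RHS]mxE eqxx mulr1n.
by rewrite -invfM -expr2 sqr_sqrtr ?ltW// mulVf// gt_eqF.
Qed.

Lemma gram_row_mx m k1 k2 (A : 'M[R]_(m, k1)) (B : 'M[R]_(m, k2)) :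
  gram A = 1%:M -> gram B = 1%:M -> B^T *m A = 0 -> gram (row_mx A B) = 1%:M.
Proof.
move=> AA BB BA; rewrite /gram tr_row_mx mul_col_row -/(gram A) -/(gram B) AA BB BA.
rewrite (_ : A^T *m B = 0); first by rewrite -scalar_mx_block.
by rewrite -[LHS]trmxK trmx_mul trmxK BA trmx0.
Qed.

Lemma mx_inj_rsub m k (B : 'M[R]_(m, 1 + k)) : mx_inj B -> mx_inj (rsubmx B).
Proof.
move=> B0 v Bv; have := B0 (col_mx 0 v).
rewrite -{1}[B]hsubmxK mul_row_col mulmx0 add0r => /(_ Bv).
by rewrite -(col_mx0 R 1 k 1) => /eq_col_mx[].
Qed.

(** Otherwise the first column of B would be a combination of the others. *)
Lemma residue_neq0 m k (B : 'M[R]_(m, 1 + k)) (Q : 'M[R]_(m, k)) T :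
  mx_inj B -> Q = rsubmx B *m T -> gs_residue (lsubmx B) Q != 0.
Proof.
move=> B0 QE; apply/eqP => r0.
(* The kernel vector (1, - T Q^T b): b minus its expansion in the other columns. *)
have := B0 (col_mx 1%:M (- (T *m Q^T *m lsubmx B))).
rewrite -{1}[B]hsubmxK mul_row_col mulmx1 mulmxN !mulmxA -QE.
rewrite -/(gs_residue (lsubmx B) Q) r0 => /(_ erefl).
rewrite -(col_mx0 R 1 k 1) => /eq_col_mx[/matrixP/(_ 0 0)].
by rewrite !mxE => /eqP; rewrite oner_eq0.
Qed.

Lemma gs_factor m k (B : 'M[R]_(m, 1 + k)) (Q : 'M[R]_(m, k)) T :
  Q = rsubmx B *m T ->
  exists S, row_mx (gs_normalize (gs_residue (lsubmx B) Q)) Q = B *m S.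
Proof.
move=> QT; rewrite /gs_normalize; set a := (Num.sqrt _)^-1.
(* The first column of S expresses a (b - Q Q^T b) through the columns of B. *)
exists (block_mx a%:M 0 (- (a *: (T *m Q^T *m lsubmx B))) T).
rewrite -{2}[B]hsubmxK mul_row_block mulmx0 add0r -QT; congr row_mx.
by rewrite mul_mx_scalar mulmxN -scalemxAr !mulmxA -QT -scalerBr.
Qed.

Lemma gram_schmidtP m k (B : 'M[R]_(m, k)) : mx_inj B ->
  gram (gram_schmidt B) = 1%:M /\ exists T, gram_schmidt B = B *m T.
Proof.
elim: k B => [|k IH] B B0.
  split; first by apply/matrixP => -[].
  by exists 1%:M; rewrite mulmx1.
have [QQ [T QT]] := IH _ (mx_inj_rsub B0).
rewrite /=; set Q := gram_schmidt _ in QQ QT *.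
have r0 := residue_neq0 B0 QT; set r := gs_residue _ Q in r0 *.
have Qr : Q^T *m r = 0.
  by rewrite /r /gs_residue mulmxBr -mulmxA (mulmxA Q^T) -/(gram Q) QQ mul1mx subrr.
have Qn : Q^T *m gs_normalize r = 0 by rewrite -scalemxAr Qr scaler0.
split.
  by apply: (gram_row_mx (k1 := 1)) => //; exact: dot_normalize.
exact: gs_factor QT.
Qed.

Lemma mx_inj_gram m k (Q : 'M[R]_(m, k)) : gram Q = 1%:M -> mx_inj Q.
Proof. by move=> QQ v Qv; rewrite -[v]mul1mx -QQ -mulmxA Qv mulmx0. Qed.

Lemma gram_schmidt_image m k (B : 'M[R]_(m, k)) : mx_inj B ->
  mx_image (gram_schmidt B) fullv = mx_image B fullv.
Proof.
move=> B0; have [QQ [T QT]] := gram_schmidtP B0.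
apply/eqP; rewrite eqEdim !dim_frame ?leqnn ?andbT//; last exact: mx_inj_gram.
apply/subvP => v /mem_mx_span[u ->]; apply/mem_mx_span.
by exists (T *m u); rewrite QT mulmxA.
Qed.

(** The square root is only taken of the squared norms of the residues, which
    do not vanish for an injective matrix. *)
Lemma smooth_gram_schmidt (V : normedModType R) (U : set V) m k
    (f : V -> 'M[R]_(m, k)) : open U -> (forall x, U x -> mx_inj (f x)) ->
  smooth_on U f -> smooth_on U (fun x => gram_schmidt (f x)).
Proof.
move=> oU; elim: k f => [//|k IH] f f0 sf.
have sQ : smooth_on U (fun x => gram_schmidt (rsubmx (f x : 'M[R]_(m, 1 + k)))).
  apply: IH; first by move=> x /f0; exact: mx_inj_rsub.
  exact: (smooth_rsubmx oU (m := 1)).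
have sr : smooth_on U (fun x => gs_residue (lsubmx (f x : 'M[R]_(m, 1 + k)))
    (gram_schmidt (rsubmx (f x : 'M[R]_(m, 1 + k))))).
  have sl : smooth_on U (fun x => lsubmx (f x : 'M[R]_(m, 1 + k))).
    exact: (smooth_lsubmx oU (m := 1)).
  apply: smoothB => //; apply: smooth_mulmx => //; apply: smooth_mulmx => //.
  exact: smooth_trmx.
apply: (smooth_row_mx oU (n := 1)) => //.
have r0 x : U x -> gs_residue (lsubmx (f x : 'M[R]_(m, 1 + k)))
    (gram_schmidt (rsubmx (f x : 'M[R]_(m, 1 + k)))) != 0.
  move=> /f0 fx; have [_ [T QT]] := gram_schmidtP (mx_inj_rsub fx).
  exact: residue_neq0 QT.
apply: smoothZ => //; apply: smoothV => //.
  by move=> x /r0/dot_gt0 d0; rewrite gt_eqF// sqrtr_gt0.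
apply: smooth_sqrt => //; first by move=> x /r0/dot_gt0.
apply: smooth_entry => //; apply: smooth_mulmx => //; exact: smooth_trmx.
Qed.

End GramSchmidt.

(** * Sections of the orbit map and transitivity *)

Section EuclideanGroup.
Context {R : realType} (n : nat).

Lemma SE_group : Defs.is_group (SE R n) se_mul se_one se_inv.
Proof.
split.
- by split; rewrite ?det1// /in_O trmx1 mulmx1.
- move=> g h [gO dg] [hO dh]; split; last by rewrite /= det_mulmx dg dh mulr1.
  by rewrite /in_O /= trmx_mul mulmxA -(mulmxA g.1) hO mulmx1.
- move=> g [gO dg]; split; rewrite /= in_O_inv ?det_tr//.
  by rewrite /in_O trmxK in_O_tr.
- move=> [A X] [B Y] [C Z] _ _ _; rewrite /se_mul /= !mulmxA mulmxDr addrA.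
  by rewrite mulmxA.
- move=> [A X] [/= /in_O_unit uA _]; rewrite /se_mul /se_inv /se_one /=.
  split; congr pair; rewrite ?mul1mx ?mulmx1 ?mulVmx ?mulmxV ?add0r ?mulmx0 ?addr0//.
  - by rewrite addNr.
  - by rewrite mulmxN mulmxA mulmxV// mul1mx subrr.
Qed.

End EuclideanGroup.

Section BundleSection.
Context {R : realType} (p q : nat) (hp : (0 < p)%N).
Local Notation n := (p + q)%N.
Local Notation aff := ('M[R]_n * 'cV[R]_n)%type.
Implicit Types (s : 'S_n) (M : 'M[R]_(q, p)).

(** The columns span the normal space of the graph of M. *)
Definition normal_frame s M : 'M[R]_(n, q) := perm_mx s *m col_mx (- M^T) 1%:M.

Lemma normal_frame_inj s M : mx_inj (normal_frame s M).
Proof.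
move=> v E; have : dsubmx ((perm_mx s)^T *m (normal_frame s M *m v)) = v.
  by rewrite !mulmxA perm_mxKT mul1mx mul_col_mx mul1mx col_mxKd.
by move=> <-; rewrite E mulmx0; apply/matrixP => i j; rewrite !mxE.
Qed.

Lemma normal_frame_orth s M : (normal_frame s M)^T *m graph_frame s M = 0.
Proof.
rewrite trmx_mul -mulmxA (mulmxA (perm_mx s)^T) perm_mxKT mul1mx tr_col_mx.
by rewrite mul_row_col linearN /= trmxK trmx1 mulmx1 mul1mx addNr.
Qed.

(** Scales the first vector by d.  With d = 1 or -1 it corrects the orientation
    of a basis without changing the spans. *)
Definition first_scale (d : R) : 'M[R]_p :=
  diag_mx (\row_(j < p) if (j == 0 :> nat) then d else 1).

Lemma det_first_scale d : \det (first_scale d) = d.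
Proof.
rewrite det_diag (bigD1 (Ordinal hp)) //= mxE /= big1 ?mulr1// => j j0.
by rewrite mxE ifF//; apply: contraNF j0 => /eqP j0; apply/eqP/val_inj.
Qed.

Lemma first_scale_sqr d : d * d = 1 -> first_scale d *m first_scale d = 1%:M.
Proof.
move=> dd; rewrite /first_scale mulmx_diag -diag_const_mx; congr diag_mx.
by apply/rowP => j; rewrite !mxE; case: ifP; rewrite ?mulr1.
Qed.

Definition adapted_basis s M : 'M[R]_n :=
  row_mx (gram_schmidt (graph_frame s M)) (gram_schmidt (normal_frame s M)).

(** An orthonormal basis adapted to the plane and its normal space, made
    positive by multiplying its first vector by its determinant.  Unlike a
    case distinction on the sign, this is visibly smooth in M. *)
Definition adapted_rot s M : 'M[R]_n :=
  row_mx (gram_schmidt (graph_frame s M) *m first_scale (\det (adapted_basis s M)))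
    (gram_schmidt (normal_frame s M)).

Lemma gs_orth s M :
  (gram_schmidt (normal_frame s M))^T *m gram_schmidt (graph_frame s M) = 0.
Proof.
have [_ [T ->]] := gram_schmidtP (@graph_frame_inj R p q s M).
have [_ [T' ->]] := gram_schmidtP (@normal_frame_inj s M).
by rewrite trmx_mul mulmxA -(mulmxA T'^T) normal_frame_orth mulmx0 mul0mx.
Qed.

Lemma gram_in_O m (A : 'M[R]_m) : gram A = 1%:M -> in_O A.
Proof. exact: mulmx1C. Qed.

Lemma det_in_O m (A : 'M[R]_m) : in_O A -> \det A * \det A = 1.
Proof. by move=> AO; rewrite -{2}det_tr -det_mulmx AO det1. Qed.

Lemma adapted_basis_O s M : in_O (adapted_basis s M).
Proof.
have [F1 _] := gram_schmidtP (@graph_frame_inj R p q s M).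
have [N1 _] := gram_schmidtP (@normal_frame_inj s M).
by apply: gram_in_O; apply: gram_row_mx => //; exact: gs_orth.
Qed.

(** The determinant d of the adapted basis satisfies d^2 = 1, and the scaling
    multiplies it by d. *)
Lemma adapted_rot_SO s M : in_SO (adapted_rot s M).
Proof.
have [F1 _] := gram_schmidtP (@graph_frame_inj R p q s M).
have [N1 _] := gram_schmidtP (@normal_frame_inj s M).
have dd := det_in_O (adapted_basis_O s M).
split.
  apply: gram_in_O; apply: gram_row_mx => //; last by rewrite mulmxA gs_orth mul0mx.
  rewrite /gram trmx_mul -mulmxA (mulmxA _^T (gram_schmidt _)) -/(gram _) F1 mul1mx.
  by rewrite tr_diag_mx first_scale_sqr.
have -> : adapted_rot s M = adapted_basis s M *m
    block_mx (first_scale (\det (adapted_basis s M))) 0 0 1%:M.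
  by rewrite mul_row_block !mulmx0 mulmx1 addr0 add0r.
by rewrite det_mulmx det_ublock det1 mulr1 det_first_scale.
Qed.

Lemma adapted_rot_base s M :
  mx_image (adapted_rot s M) (@base_plane R p q) = mx_image (graph_frame s M) fullv.
Proof.
rewrite -mx_imageM mul_row_col mulmx1 mulmx0 addr0 mx_imageM.
rewrite -(gram_schmidt_image (@graph_frame_inj R p q s M)); congr mx_image.
apply/vspaceP => v; rewrite memvf; apply/mem_mx_span.
exists (first_scale (\det (adapted_basis s M)) *m v).
by rewrite mulmxA first_scale_sqr ?mul1mx// det_in_O//; exact: adapted_basis_O.
Qed.

(** The translation part is Y / 2 because the action on base_pt doubles the
    projection of the translation. *)
Definition bundle_sec s (w : 'rV[R]_(bundle_dim p q)) : aff :=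
  let M := vec_mx (lsubmx w) in
  (adapted_rot s M, 2^-1 *: (graph_frame s M *m (rsubmx w)^T)).

Lemma bundle_sec_SE s w : SE R n (bundle_sec s w).
Proof. exact: adapted_rot_SO. Qed.

Lemma bundle_secP s w :
  star (bundle_sec s w) (base_pt p q) = pfun (bundle_param s) w.
Proof.
rewrite /star /base_pt /= adapted_rot_base; congr pair.
have fP := frame_is_proj (@graph_frame_inj R p q s (vec_mx (lsubmx w))).
rewrite (pr_is_proj _ fP) mulmx0 add0r -scalemxAr scalerA mulfV ?scale1r; last first.
  by rewrite pnatr_eq0.
have [_ _ Pm] := fP; apply/eqP; rewrite -Pm; apply/mem_mx_span.
by exists (rsubmx w)^T.
Qed.

Lemma smooth_bundle_sec s : smooth_on setT (bundle_sec s).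
Proof.
have oT := @openT 'rV[R]_(bundle_dim p q).
have sM : smooth_on setT (fun w : 'rV[R]_(bundle_dim p q) =>
    vec_mx (lsubmx w) : 'M[R]_(q, p)).
  apply: smooth_vec_mx => //; apply: smooth_linear => //; first exact: findim_mx.
  exact: linearP.
have sw : smooth_on setT (fun w : 'rV[R]_(bundle_dim p q) => (rsubmx w)^T).
  apply: smooth_trmx => //; apply: smooth_linear => //; first exact: findim_mx.
  exact: linearP.
have sB : smooth_on setT (fun w : 'rV[R]_(bundle_dim p q) =>
    graph_frame s (vec_mx (lsubmx w))).
  apply: smooth_mulmx => //; first exact: smooth_cst.
  by apply: smooth_col_mx => //; exact: smooth_cst.
have sN : smooth_on setT (fun w : 'rV[R]_(bundle_dim p q) =>
    normal_frame s (vec_mx (lsubmx w))).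
  apply: smooth_mulmx => //; first exact: smooth_cst.
  apply: smooth_col_mx => //; last exact: smooth_cst.
  by apply: smoothN => //; exact: smooth_trmx.
have sgB : smooth_on setT (fun w : 'rV[R]_(bundle_dim p q) =>
    gram_schmidt (graph_frame s (vec_mx (lsubmx w)))).
  by apply: smooth_gram_schmidt => // x _; exact: graph_frame_inj.
have sgN : smooth_on setT (fun w : 'rV[R]_(bundle_dim p q) =>
    gram_schmidt (normal_frame s (vec_mx (lsubmx w)))).
  by apply: smooth_gram_schmidt => // x _; exact: normal_frame_inj.
have sd : smooth_on setT (fun w : 'rV[R]_(bundle_dim p q) =>
    \det (adapted_basis s (vec_mx (lsubmx w)))).
  by apply: smooth_det => //; exact: smooth_row_mx.
apply: smooth_pair => //; [exact: findim_mx|exact: findim_mx| | ]; last first.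
  by apply: smoothZl => //; exact: smooth_mulmx.
apply: smooth_row_mx => //; apply: smooth_mulmx => //.
apply: smooth_mx => // i j; under eq_fun do rewrite !mxE mulrb.
case: (i == j); last exact: smooth_cst.
by case: (i == 0 :> nat); [exact: sd|exact: smooth_cst].
Qed.

(** Every point of the bundle is the image of base_pt under a value of one of
    the sections. *)
Lemma star_transitive : transitive_action (SE R n) (Cnp R p q) star.
Proof.
split; first by exists (base_pt p q); exact: base_pt_Cnp.
move=> x y Cx Cy; have [actC act1 actM] := @star_action R p q.
have reach z : Cnp R p q z -> exists2 g, SE R n g & star g (base_pt p q) = z.
  move=> /covers_bundle[_ [s _ <-] [w _ <-]].
  by exists (bundle_sec s w); [exact: bundle_sec_SE|exact: bundle_secP].
have [g Gg <-] := reach _ Cx; have [h Gh <-] := reach _ Cy.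
have [_ Gm Gv _ G1] := @SE_group R n; have [_ _ gVg _] := G1 _ Gg.
have bC := @base_pt_Cnp R p q.
exists (se_mul h (se_inv g)); first by apply: Gm => //; exact: Gv.
rewrite actM//; [|exact: Gv|exact: actC].
by rewrite -(actM (se_inv g) g)//; [rewrite gVg act1|exact: Gv].
Qed.

End BundleSection.

(** * Cayley transform and signs *)

Section Cayley.
Context {R : realType} (n : nat).
Implicit Types (A S : 'M[R]_n).

Definition sign_mx (I : {set 'I_n}) : 'M[R]_n :=
  diag_mx (\row_i if i \in I then -1 else 1).

Lemma sign_mx_sqr I : sign_mx I *m sign_mx I = 1%:M.
Proof.
rewrite /sign_mx mulmx_diag -diag_const_mx; congr diag_mx.
by apply/rowP => j; rewrite !mxE; case: ifP; rewrite ?mulrNN mulr1.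
Qed.

Lemma sign_mx_O I : in_O (sign_mx I).
Proof. by rewrite /in_O tr_diag_mx sign_mx_sqr. Qed.

Lemma det_sign_mx I : \det (sign_mx I) = (-1) ^+ #|I|.
Proof.
rewrite det_diag; under eq_bigr do rewrite mxE.
by rewrite -big_mkcond /= prodr_const.
Qed.

(** Multiply det (D + A) by det D and sum over all diagonal sign matrices D.
    In the Leibniz expansion the sum over the i-th sign of
    d_i (d_i delta + A i (s i)) is 2 delta, where delta tells whether s fixes i,
    so the total is det 2 = 2^n, and some term does not vanish. *)
Lemma sign_shift_unit A : exists I, sign_mx I + A \in unitmx.
Proof.
pose sg (b : bool) : R := (-1) ^+ b.
pose D (f : {ffun 'I_n -> bool}) : 'M[R]_n := diag_mx (\row_i sg (f i)).
have E : \sum_(f : {ffun 'I_n -> bool}) (\prod_i sg (f i)) * \det (D f + A)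
    = 2 ^+ n.
  transitivity (\det (2%:M : 'M[R]_n)); last by rewrite det_scalar.
  under eq_bigr do rewrite /determinant mulr_sumr.
  rewrite exchange_big /=; apply: eq_bigr => s _.
  transitivity ((-1) ^+ s * \sum_(f : {ffun 'I_n -> bool})
     \prod_i (sg (f i) * (sg (f i) *+ (i == s i) + A i (s i)))).
    rewrite mulr_sumr; apply: eq_bigr => f _; rewrite mulrCA; congr (_ * _).
    by rewrite -big_split; apply: eq_bigr => i _; rewrite !mxE.
  rewrite -(bigA_distr_bigA (fun i b => sg b * (sg b *+ (i == s i) + A i (s i)))).
  congr (_ * _); apply: eq_bigr => i _; rewrite big_bool /sg /= expr1 expr0 mxE.
  case: eqP => _; rewrite ?mulr1n ?mulr0n; ring.
have : exists f, \det (D f + A) != 0.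
  apply: contrapT => H; have /eqP := E; rewrite big1 => [|f _].
    by rewrite eq_sym expf_eq0 pnatr_eq0 andbF.
  have [->|d0] := eqVneq (\det (D f + A)) 0; first by rewrite mulr0.
  by case: H; exists f.
move=> [f df]; exists (finset f).
rewrite unitmxE unitfE (_ : sign_mx _ = D f)//; congr diag_mx.
by apply/rowP => i; rewrite !mxE inE /sg; case: (f i).
Qed.

Lemma sign_mul_unit A : exists I, 1%:M + sign_mx I *m A \in unitmx.
Proof.
have [I u] := sign_shift_unit A; exists I.
rewrite -(sign_mx_sqr I) -mulmxDr unitmx_mul u andbT.
exact: in_O_unit (sign_mx_O I).
Qed.

Definition skew_sym S : Prop := S^T = - S.

(** On matrices S with 1 + S invertible this is an involution, which exchanges
    skew-symmetric and special orthogonal matrices. *)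
Definition cayley S : 'M[R]_n := (1%:M - S) *m invmx (1%:M + S).

Lemma skew_dot S (v : 'rV_n) : skew_sym S -> v *m S *m v^T = 0.
Proof.
move=> sS; have E : (v *m S *m v^T)^T = - (v *m S *m v^T).
  by rewrite !trmx_mul trmxK sS mulmxA mulmxN mulNmx.
apply/matrixP => i j; have := congr1 (fun M : 'M[R]_1 => M i j) E.
rewrite [in LHS]mxE [in RHS]mxE !ord1 => /eqP; rewrite [RHS]mxE.
by rewrite -subr_eq0 opprK -mulr2n mulrn_eq0 => /eqP.
Qed.

(** If v (1 + S) = 0 then |v|^2 = - v S v^T = 0. *)
Lemma skew_unit S : skew_sym S -> 1%:M + S \in unitmx.
Proof.
move=> sS; rewrite -row_free_unit; apply: inj_row_free => v vE.
apply: trmx_inj; rewrite trmx0; apply: dot_eq0; rewrite dotE trmxK.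
have := congr1 (fun M => M *m v^T) vE.
rewrite mulmxDr mulmx1 mulmxDl (skew_dot _ sS) addr0 mul0mx => ->.
by rewrite mxE.
Qed.

Lemma skewN S : skew_sym S -> skew_sym (- S).
Proof. by rewrite /skew_sym linearN /= => ->. Qed.

Lemma skewZ a S : skew_sym S -> skew_sym (a *: S).
Proof. by rewrite /skew_sym linearZ /= => ->; rewrite scalerN. Qed.

Lemma cayley_comm S : (1%:M - S) *m (1%:M + S) = (1%:M + S) *m (1%:M - S).
Proof.
rewrite !(mulmxDl, mulmxDr, mulNmx, mulmxN, mul1mx, mulmx1); set SS := S *m S.
by apply/matrixP => i j; rewrite !mxE; ring.
Qed.

Lemma cayley_SO S : skew_sym S -> in_SO (cayley S).
Proof.
move=> sS; have u1 := skew_unit sS; have u2 := skew_unit (skewN sS).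
have T1 : (1%:M + S)^T = 1%:M - S by rewrite linearD /= trmx1 sS.
have T2 : (1%:M - S)^T = 1%:M + S by rewrite linearB /= trmx1 sS opprK.
split.
  apply: mulmx1C; rewrite /cayley trmx_mul T2 trmx_inv T1.
  rewrite mulmxA -(mulmxA _ (1%:M + S)) -cayley_comm !mulmxA mulVmx//.
  by rewrite mul1mx mulmxV.
by rewrite /cayley det_mulmx det_inv -T1 det_tr divrr.
Qed.

Lemma cayley_addl S : 1%:M + S \in unitmx ->
  1%:M + cayley S = 2 *: invmx (1%:M + S).
Proof.
move=> u; rewrite -[X in X + _](mulmxV u) -mulmxDl addrACA subrr addr0.
by rewrite -mulr2n -scaler_nat -scalemxAl mul1mx.
Qed.

Lemma cayley_subl S : 1%:M + S \in unitmx ->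
  1%:M - cayley S = 2 *: (S *m invmx (1%:M + S)).
Proof.
move=> u; rewrite -[X in X - _](mulmxV u) -mulmxBl scalemxAl; congr (_ *m _).
by apply/matrixP => i j; rewrite !mxE; ring.
Qed.

Lemma cayley_unit S : 1%:M + S \in unitmx -> 1%:M + cayley S \in unitmx.
Proof.
move=> u; rewrite cayley_addl// unitmxZ ?unitmx_inv//.
by rewrite unitfE pnatr_eq0.
Qed.

Lemma cayleyK S : 1%:M + S \in unitmx -> cayley (cayley S) = S.
Proof.
move=> u; rewrite {1}/cayley cayley_subl// cayley_addl//.
have u2 : (2 : R) \is a GRing.unit by rewrite unitfE pnatr_eq0.
rewrite invmxZ ?unitmx_inv// ?invmxK; last by rewrite unitmxZ ?unitmx_inv.
rewrite -scalemxAl -scalemxAr scalerA mulrV// scale1r -mulmxA mulVmx// mulmx1.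
by [].
Qed.

Lemma cayley_skew A : in_O A -> 1%:M + A \in unitmx -> skew_sym (cayley A).
Proof.
move=> AO u; have AO' := in_O_tr AO.
(* Both sides of the claim become A - A^T when the inverses are cleared. *)
have uT : 1%:M + A^T \in unitmx by rewrite -unitmx_tr linearD /= trmx1 trmxK.
rewrite /skew_sym /cayley trmx_mul trmx_inv [(_ - _)^T]linearB.
rewrite [(_ + _)^T]linearD /= trmx1.
have E : (1%:M - A^T) *m (1%:M + A) = - ((1%:M + A^T) *m (1%:M - A)).
  rewrite !(mulmxDl, mulmxDr, mulNmx, mulmxN, mul1mx, mulmx1) AO'.
  by apply/matrixP => i j; rewrite !mxE; ring.
have := congr1 (fun M => invmx (1%:M + A^T) *m M *m invmx (1%:M + A)) E.
rewrite mulmxN mulNmx !mulmxA mulVmx// mul1mx -!mulmxA mulmxV// mulmx1.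
by [].
Qed.

End Cayley.

Section SkewCoordinates.
Context {R : realType} (n : nat).

Definition upper_pairs : {set 'I_n * 'I_n} :=
  finset (fun ij : 'I_n * 'I_n => (ij.1 < ij.2)%N).

(** Counted by the second index, this is the sum 0 + 1 + ... + (n - 1). *)
Lemma card_upper_pairs : 'C(n, 2) = #|upper_pairs|.
Proof.
rewrite -triangular_sum big_mkord -sum1dep_card.
rewrite (eq_bigr (fun j : 'I_n => \sum_(i < n | i < j) 1)%N); last first.
  move=> j _; rewrite -(big_ord_widen n (fun=> 1%N) (ltnW (ltn_ord j))).
  by rewrite sum_nat_const card_ord muln1.
rewrite (exchange_big_dep xpredT) //= pair_big_dep /=.
by apply: eq_bigl => -[i j].
Qed.

(** Numbers the entries above the diagonal by the coordinates of R^'C(n, 2). *)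
Definition upper_pair (k : 'I_('C(n, 2))) : 'I_n * 'I_n :=
  enum_val (cast_ord card_upper_pairs k).

Lemma upper_pair_inj : injective upper_pair.
Proof. by move=> k k' /enum_val_inj/cast_ord_inj. Qed.

Lemma upper_pairP k : ((upper_pair k).1 < (upper_pair k).2)%N.
Proof. by have := enum_valP (cast_ord card_upper_pairs k); rewrite inE. Qed.

Lemma upper_pair_surj (i j : 'I_n) : (i < j)%N -> exists k, upper_pair k = (i, j).
Proof.
move=> ij; have ijP : (i, j) \in upper_pairs by rewrite inE.
exists (cast_ord (esym card_upper_pairs) (enum_rank_in ijP (i, j))).
by rewrite /upper_pair cast_ordKV enum_rankK_in.
Qed.

Definition upper_coord (S : 'M[R]_n) : 'rV[R]_('C(n, 2)) :=
  \row_k S (upper_pair k).1 (upper_pair k).2.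

Definition skew_mx (w : 'rV[R]_('C(n, 2))) : 'M[R]_n :=
  \sum_k w 0 k *: (delta_mx (upper_pair k).1 (upper_pair k).2 -
                   delta_mx (upper_pair k).2 (upper_pair k).1).

Lemma skew_mxP w : skew_sym (skew_mx w).
Proof.
rewrite /skew_sym /skew_mx linear_sum -sumrN; apply: eq_bigr => k _.
by rewrite linearZ linearB /= !trmx_delta -scalerN opprB.
Qed.

Lemma skew_mxK w : upper_coord (skew_mx w) = w.
Proof.
apply/rowP => k; rewrite mxE summxE (bigD1 k) //= big1 => [|k' k'k]; rewrite !mxE.
  rewrite !eqxx /= addr0 [X in _ - X](_ : _ = 0) ?subr0 ?mulr1//.
  have := upper_pairP k; case: eqP => [->|//]; by rewrite ltnn.
have /negPf -> : ~~ (((upper_pair k).1 == (upper_pair k').1) &&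
    ((upper_pair k).2 == (upper_pair k').2)).
  apply: contra k'k => /andP[/eqP E1 /eqP E2]; apply/eqP/upper_pair_inj.
  by rewrite [LHS]surjective_pairing [RHS]surjective_pairing E1 E2.
have /negPf -> : ~~ (((upper_pair k).1 == (upper_pair k').2) &&
    ((upper_pair k).2 == (upper_pair k').1)).
  apply/negP => /andP[/eqP E1 /eqP E2]; have := upper_pairP k.
  by rewrite E1 E2 ltnNge ltnW// upper_pairP.
by rewrite subr0 mulr0.
Qed.

(** The remaining entries of a skew-symmetric matrix are determined by those
    above the diagonal. *)
Lemma upper_coord_eq (S S' : 'M[R]_n) : skew_sym S -> skew_sym S' ->
  upper_coord S = upper_coord S' -> S = S'.
Proof.
move=> sS sS' E.
have up (i j : 'I_n) : (i < j)%N -> S i j = S' i j.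
  by move=> /upper_pair_surj[k kE]; have /rowP/(_ k) := E; rewrite !mxE kE.
have tr (T : 'M[R]_n) i j : skew_sym T -> T i j = - T j i.
  by move=> sT; have /matrixP/(_ j i) := sT; rewrite !mxE.
apply/matrixP => i j; have [ij|ji|/val_inj ->] := ltngtP i j.
- exact: up.
- by rewrite (tr S)// (tr S')// up.
have d0 (T : 'M[R]_n) : skew_sym T -> T j j = 0.
  move=> sT; have /eqP := tr T j j sT.
  by rewrite -subr_eq0 opprK -mulr2n mulrn_eq0 => /eqP.
by rewrite !d0.
Qed.

Lemma upper_coordK S : skew_sym S -> skew_mx (upper_coord S) = S.
Proof.
by move=> sS; apply: upper_coord_eq => //; [exact: skew_mxP|exact: skew_mxK].
Qed.

End SkewCoordinates.

(** * The Lie group SE(n) *)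

Section EuclideanGroupManifold.
Context {R : realType} (n : nat).
Local Notation aff := ('M[R]_n * 'cV[R]_n)%type.
Local Notation mparams M := (@mparam _ _ M).
Local Notation sgn I := (@sign_mx R n I).
Implicit Types (I : {set 'I_n}) (w : 'rV[R]_(se_dim n)).

Lemma smooth_cayley (V : normedModType R) (U : set V) (f : V -> 'M[R]_n) :
  open U -> (forall x, U x -> 1%:M + f x \in unitmx) ->
  smooth_on U f -> smooth_on U (fun x => cayley (f x)).
Proof.
move=> oU uf sf; have s1 : smooth_on U (fun=> 1%:M : 'M[R]_n) by exact: smooth_cst.
apply: smooth_mulmx => //; first exact: smoothB.
by apply: smooth_invmx => //; exact: smoothD.
Qed.

Lemma smooth_skew_mx (V : normedModType R) (U : set V)
    (f : V -> 'rV[R]_('C(n, 2))) : open U ->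
  smooth_on U f -> smooth_on U (fun x => skew_mx (f x)).
Proof.
move=> oU sf; apply: smooth_sum => // k _; apply: smoothZ => //.
  exact: smooth_entry.
exact: smooth_cst.
Qed.

Lemma smooth_upper_coord (V : normedModType R) (U : set V) (f : V -> 'M[R]_n) :
  open U -> smooth_on U f -> smooth_on U (fun x => upper_coord (f x)).
Proof.
move=> oU sf; apply: smooth_mx => // i j; under eq_fun do rewrite mxE.
exact: smooth_entry.
Qed.

Definition se_chart I : @local_param R aff (se_dim n) :=
  LocalParam setT (fun w : 'rV[R]_(se_dim n) =>
    (sgn I *m cayley (skew_mx (lsubmx w)), (rsubmx w)^T)).

Definition se_chart_dom I : set aff :=
  [set y | 1%:M + sgn I *m y.1 \in unitmx].

Definition se_chart_inv I (y : aff) : 'rV[R]_(se_dim n) :=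
  row_mx (upper_coord (cayley (sgn I *m y.1))) (y.2)^T.

Lemma se_chartK I w : se_chart_inv I (pfun (se_chart I) w) = w.
Proof.
rewrite /se_chart_inv /= mulmxA sign_mx_sqr mul1mx cayleyK.
  by rewrite skew_mxK trmxK hsubmxK.
by apply: skew_unit; exact: skew_mxP.
Qed.

Lemma se_chart_invK I y : SE R n y -> se_chart_dom I y ->
  pfun (se_chart I) (se_chart_inv I y) = y.
Proof.
case: y => A X [/= AO _] u; rewrite /se_chart_inv row_mxKl row_mxKr trmxK /=.
have DAO : in_O (sgn I *m A).
  by rewrite /in_O trmx_mul mulmxA -(mulmxA (sgn I)) AO mulmx1; exact: sign_mx_O.
rewrite upper_coordK; last exact: cayley_skew.
by rewrite cayleyK// mulmxA sign_mx_sqr mul1mx.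
Qed.

Lemma open_se_chart_dom I : open (se_chart_dom I).
Proof.
have oT := @openT aff.
have sd : smooth_on setT (fun y : aff => \det (1%:M + sgn I *m y.1)).
  apply: smooth_det => //; apply: smoothD => //; first exact: smooth_cst.
  by apply: smooth_mulmx => //; [exact: smooth_cst|exact: smooth_affine_fst].
have := open_preimage_in oT (fun x => @smooth_cont _ _ _ _ _ x sd) (@open_neq R^o 0).
rewrite setTI; congr open; apply/seteqP.
by split=> y; rewrite /se_chart_dom /= unitmxE unitfE.
Qed.

Lemma smooth_se_chart I : smooth_on setT (pfun (se_chart I)).
Proof.
have oT := @openT 'rV[R]_(se_dim n).
apply: smooth_pair => //; [exact: findim_mx|exact: findim_mx| | ].
  apply: smooth_mulmx => //; first exact: smooth_cst.
  apply: smooth_cayley => //; first by move=> w _; apply: skew_unit; exact: skew_mxP.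
  apply: smooth_skew_mx => //; apply: smooth_linear => //; first exact: findim_mx.
  exact: linearP.
apply: smooth_trmx => //; apply: smooth_linear => //; first exact: findim_mx.
exact: linearP.
Qed.

Lemma smooth_se_chart_inv I : smooth_on (se_chart_dom I) (se_chart_inv I).
Proof.
have oD := @open_se_chart_dom I.
apply: smooth_row_mx => //.
  apply: smooth_upper_coord => //; apply: smooth_cayley => //.
  apply: smooth_mulmx => //; first exact: smooth_cst.
  exact: smooth_sub (@subsetT _ _) (@smooth_affine_fst R n).
apply: smooth_trmx => //.
exact: smooth_sub (@subsetT _ _) (@smooth_affine_snd R n).
Qed.

Lemma se_chart_SE I w : \det (sgn I) = 1 -> SE R n (pfun (se_chart I) w).
Proof.
move=> dI; have [CO dC] := cayley_SO (skew_mxP (lsubmx w)).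
split; last by rewrite /= det_mulmx dI dC mulr1.
rewrite /in_O /= trmx_mul mulmxA -(mulmxA (sgn I)) CO mulmx1.
exact: sign_mx_O.
Qed.

Lemma se_chart_dom_param I w : se_chart_dom I (pfun (se_chart I) w).
Proof.
rewrite /se_chart_dom /= mulmxA sign_mx_sqr mul1mx.
by apply: cayley_unit; apply: skew_unit; exact: skew_mxP.
Qed.

(** The image of the chart is cut out of SE(n) by the open condition that
    1 + D A is invertible, and the inverse is defined and smooth there. *)
Lemma se_chart_param I : \det (sgn I) = 1 ->
  mparams (SE_manifold R n) (se_chart I).
Proof.
move=> dI; split=> /=.
- exact: openT.
- exact: smooth_se_chart.
- exists (se_chart_dom I); first exact: open_se_chart_dom.
  apply/seteqP; split=> [_ [w _ <-]|y [Gy dy]].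
    by split; [exact: se_chart_SE|exact: se_chart_dom_param].
  by exists (se_chart_inv I y) => //; exact: se_chart_invK.
exists (se_chart_inv I); split; last by move=> w _; exact: se_chartK.
move=> _ [w _ <-]; exists (se_chart_dom I), (se_chart_inv I); split=> //.
- exact: open_se_chart_dom.
- exact: se_chart_dom_param.
- exact: smooth_se_chart_inv.
Qed.

(** Signs D with 1 + D A invertible exist for any A.  Then D A is a Cayley
    transform of a skew-symmetric matrix, hence of determinant 1, and so is D. *)
Lemma SE_cayley g : SE R n g ->
  exists I, \det (sgn I) = 1 /\ se_chart_dom I g.
Proof.
move=> [gO dg]; have [I uI] := sign_mul_unit g.1; exists I; split=> //.
(* The Cayley transform of D A is skew, so its own transform D A has determinant 1. *)
have DO : in_O (sgn I *m g.1).
  by rewrite /in_O trmx_mul mulmxA -(mulmxA (sgn I)) gO mulmx1; exact: sign_mx_O.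
have [_] := cayley_SO (cayley_skew DO uI).
by rewrite cayleyK// det_mulmx dg mulr1.
Qed.

Definition se_atlas : set (@local_param R aff (se_dim n)) :=
  [set se_chart I | I in [set I | \det (sgn I) = 1]].

Lemma covers_se : covers se_atlas (SE R n).
Proof.
move=> g Gg; have [I [dI uI]] := SE_cayley Gg.
exists (se_chart I); first by exists I.
by exists (se_chart_inv I g) => //; exact: se_chart_invK.
Qed.

Lemma embedded_SE : embedded (SE_manifold R n) id.
Proof. by apply: embedded_submanifold; exact: findim_aff. Qed.

Lemma SE_is_manifold : is_manifold (SE_manifold R n).
Proof.
apply: (embedded_manifold embedded_SE _ _ covers_se) => //.
  by apply: finite_set_countable; apply: finite_image; exact: finite_finset.
by move=> _ [I dI <-]; exact: se_chart_param.
Qed.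

Lemma smooth_fst_fst m : smooth_on setT
  (fun z : ('M[R]_n * 'cV[R]_n) * ('M[R]_m * 'cV[R]_m) => z.1.1).
Proof.
apply: smooth_linear => //; last exact: openT.
by apply: findim_prod; exact: findim_aff.
Qed.

Lemma smooth_fst_snd m : smooth_on setT
  (fun z : ('M[R]_n * 'cV[R]_n) * ('M[R]_m * 'cV[R]_m) => z.1.2).
Proof.
apply: smooth_linear => //; last exact: openT.
by apply: findim_prod; exact: findim_aff.
Qed.

Lemma smooth_snd_fst m : smooth_on setT
  (fun z : ('M[R]_m * 'cV[R]_m) * ('M[R]_n * 'cV[R]_n) => z.2.1).
Proof.
apply: smooth_linear => //; last exact: openT.
by apply: findim_prod; exact: findim_aff.
Qed.

Lemma smooth_snd_snd m : smooth_on setT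
  (fun z : ('M[R]_m * 'cV[R]_m) * ('M[R]_n * 'cV[R]_n) => z.2.2).
Proof.
apply: smooth_linear => //; last exact: openT.
by apply: findim_prod; exact: findim_aff.
Qed.

Lemma SE_lie_group : is_lie_group (SE_manifold R n) se_mul se_one se_inv.
Proof.
have [_ Gm Gv _ _] := @SE_group R n; have oT := @openT (aff * aff)%type.
split; [exact: SE_is_manifold|exact: SE_group| | ].
  apply: (smooth_map_ambient (embedded_prod embedded_SE embedded_SE) embedded_SE
    (F := fun z => se_mul z.1 z.2)) => [|[g h] [Gg Gh]]; last by split=> //; exact: Gm.
  have s11 := @smooth_fst_fst n; have s12 := @smooth_fst_snd n.
  have s21 := @smooth_snd_fst n; have s22 := @smooth_snd_snd n.
  apply: smooth_pair => //; [exact: findim_mx|exact: findim_mx|exact: smooth_mulmx|].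
  by apply: smoothD => //; exact: smooth_mulmx.
have oT1 := @openT aff.
apply: (smooth_map_ambient embedded_SE embedded_SE
  (F := fun y => (y.1^T, - (y.1^T *m y.2)))) => [|g Gg]; last first.
  by split; [exact: Gv|rewrite /se_inv in_O_inv//; case: Gg].
have s1 := @smooth_affine_fst R n; have s2 := @smooth_affine_snd R n.
have s1T : smooth_on setT (fun y : aff => (y.1)^T) by exact: smooth_trmx.
apply: smooth_pair => //; [exact: findim_mx|exact: findim_mx|].
by apply: smoothN => //; exact: smooth_mulmx.
Qed.

End EuclideanGroupManifold.

(** * Connectedness of SE(n) *)

Section Connectedness.
Context {R : realType} (n : nat).
Local Notation aff := ('M[R]_n * 'cV[R]_n)%type.
Local Notation sgn I := (@sign_mx R n I).
Local Notation linked := (connected_component (SE R n)).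

Lemma linked_path (f : R -> aff) a b : smooth_on setT f ->
  (forall t, SE R n (f t)) -> linked (f a) (f b).
Proof.
move=> sf SEf.
have cT : connected (range f).
  apply: connected_continuous_connected.
    by apply/connected_intervalP => *.
  by apply: continuous_subspaceT => t; exact: smooth_cont sf _.
have := connected_component_max (x := f a) _ _ cT.
apply; [by exists a|by move=> _ [t _ <-]|by exists b].
Qed.

Lemma SO_mul (A B : 'M[R]_n) : in_SO A -> in_SO B -> in_SO (A *m B).
Proof.
move=> [AO dA] [BO dB]; split; last by rewrite det_mulmx dA dB mulr1.
by rewrite /in_O trmx_mul mulmxA -(mulmxA A) BO mulmx1.
Qed.

Lemma cayley0 : cayley (0 : 'M[R]_n) = 1%:M.
Proof. by rewrite /cayley subr0 addr0 invmx1 mulmx1. Qed.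

Lemma linked_translation (A : 'M[R]_n) X : in_SO A -> linked (A, X) (A, 0).
Proof.
move=> AO; pose f (t : R) : aff := (A, t *: X).
have -> : (A, X) = f 1 by rewrite /f scale1r.
have -> : (A, 0) = f 0 by rewrite /f scale0r.
have oT := @openT R; apply: linked_path => //.
apply: smooth_pair => //; [exact: findim_mx|exact: findim_mx|exact: smooth_cst|].
apply: smoothZ => //; last exact: smooth_cst.
by apply: smooth_linear => //; exact: findim_R.
Qed.

(** The path t |-> B cayley (t S) C. *)
Lemma linked_cayley (B C S : 'M[R]_n) : in_SO B -> in_SO C -> skew_sym S ->
  linked (B *m cayley S *m C, 0) (B *m C, 0).
Proof.
move=> BO CO sS; pose f (t : R) : aff := (B *m cayley (t *: S) *m C, 0).
have -> : (B *m cayley S *m C, 0) = f 1 by rewrite /f scale1r.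
have -> : (B *m C, 0) = f 0 by rewrite /f scale0r cayley0 mulmx1.
have oT := @openT R.
apply: linked_path => [|t]; last first.
  by apply: SO_mul => //; apply: SO_mul => //; apply: cayley_SO; exact: skewZ.
apply: smooth_pair => //; [exact: findim_mx|exact: findim_mx| |exact: smooth_cst].
apply: smooth_mulmx => //; last exact: smooth_cst.
apply: smooth_mulmx => //; first exact: smooth_cst.
apply: smooth_cayley => //; first by move=> t _; apply: skew_unit; exact: skewZ.
apply: smoothZ => //; last exact: smooth_cst.
by apply: smooth_linear => //; exact: findim_R.
Qed.

(** The generator of the rotations of the plane of the axes i and j. *)
Definition quarter_turn (i j : 'I_n) : 'M[R]_n := delta_mx i j - delta_mx j i.

Lemma quarter_turn_skew i j : skew_sym (quarter_turn i j).
Proof. by rewrite /skew_sym linearB /= !trmx_delta opprB. Qed.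

Lemma quarter_turn_sqr i j : i != j ->
  quarter_turn i j *m quarter_turn i j = - (delta_mx i i + delta_mx j j).
Proof.
move=> ij; rewrite /quarter_turn mulmxBl !mulmxBr !mul_delta_mx_cond.
by rewrite !eqxx (negPf ij) eq_sym (negPf ij) !mulr1n !mulr0n sub0r subr0 opprD.
Qed.

Lemma quarter_turn_cube i j : i != j ->
  let K := quarter_turn i j in K *m (K *m K) = - K.
Proof.
move=> ij; rewrite /= quarter_turn_sqr// /quarter_turn mulmxN mulmxBl !mulmxDr.
rewrite !mul_delta_mx_cond !eqxx (negPf ij) eq_sym (negPf ij) !mulr1n !mulr0n.
by rewrite add0r addr0.
Qed.

(** With K^3 = - K, both (1 - K)^2 and (1 + 2 K^2) (1 + K)^2 are equal to
    1 - 2 K + K^2. *)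
Lemma cayley_sqr (K : 'M[R]_n) : skew_sym K -> K *m (K *m K) = - K ->
  cayley K *m cayley K = 1%:M + 2 *: (K *m K).
Proof.
move=> sK K3; have u := skew_unit sK; set V := invmx (1%:M + K).
(* All matrices involved are functions of K and commute. *)
have VC : V *m (1%:M - K) = (1%:M - K) *m V.
  have := congr1 (fun M => V *m M *m V) (cayley_comm K).
  by rewrite !mulmxA mulVmx// mul1mx -!mulmxA mulmxV// mulmx1.
have E : (1%:M - K) *m (1%:M - K) =
    (1%:M + 2 *: (K *m K)) *m ((1%:M + K) *m (1%:M + K)).
  rewrite !(mulmxDl, mulmxDr, mulNmx, mulmxN, mul1mx, mulmx1, opprK, opprD).
  rewrite -!scalemxAl -!(mulmxA K K) K3 !mulmxN.
  by set KK := K *m K; apply/matrixP => a b; rewrite !mxE; ring.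
rewrite /cayley -/V mulmxA -(mulmxA _ V) VC mulmxA E.
by rewrite -!mulmxA (mulmxA (1%:M + K) V) mulmxV// mul1mx mulmxV// mulmx1.
Qed.

(** For the quarter turn K of the axes i and j, 1 + 2 K^2 flips exactly the
    signs i and j. *)
Lemma sign_mx_rem (I : {set 'I_n}) i j : i != j -> i \in I -> j \in I ->
  sgn I = sgn (I :\ i :\ j) *m (1%:M + 2 *: (quarter_turn i j *m quarter_turn i j)).
Proof.
move=> ij iI jI; rewrite quarter_turn_sqr// /sign_mx mul_diag_mx.
apply/matrixP => a b; rewrite !mxE !inE.
have [<-|ab] := eqVneq a b; last first.
  have d (k : 'I_n) : (a == k) && (b == k) = false.
    by apply: contraNF ab => /andP[/eqP -> /eqP ->].
  by rewrite !d !mulr0n; ring.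
rewrite !andbb; have [->|ai] := eqVneq a i.
  rewrite iI (negPf ij) /= ?mulr1n ?mulr0n; ring.
have [->|aj] := eqVneq a j; first by rewrite jI /= ?mulr1n ?mulr0n; ring.
by case: (a \in I); rewrite /= ?mulr1n ?mulr0n; ring.
Qed.

(** The number of signs is even as the determinant is 1.  Two of them are
    removed by deforming, one after the other, both factors cayley K of their
    flip to the identity. *)
Lemma linked_sign I : \det (sgn I) = 1 -> linked (sgn I, 0) se_one.
Proof.
have [m] := ubnP #|I|; elim: m I => // m IH I; rewrite ltnS => Im dI.
have [I0|[i iI]] := set_0Vmem I.
  have -> : sgn I = 1%:M.
    by rewrite /sign_mx -diag_const_mx; congr diag_mx; apply/rowP => k;
      rewrite !mxE I0 inE.
  apply: connected_component_refl; by have [] := @SE_group R n.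
have [I1|[j]] := set_0Vmem (I :\ i).
  move: dI; rewrite det_sign_mx (cardsD1 i) iI I1 cards0 /= expr1 => /eqP.
  by rewrite eq_sym -subr_eq0 opprK -mulr2n pnatr_eq0.
rewrite !inE => /andP[ji jI]; rewrite eq_sym in ji.
have sK := quarter_turn_skew i j; have K3 := quarter_turn_cube ji.
set K := quarter_turn i j in sK K3.
have CO := cayley_SO sK.
have IE := sign_mx_rem ji iI jI; rewrite -(cayley_sqr sK K3) in IE.
have dI' : \det (sgn (I :\ i :\ j)) = 1.
  by move: dI; rewrite IE det_mulmx (SO_mul CO CO).2 mulr1.
have SI' : in_SO (sgn (I :\ i :\ j)) by split=> //; exact: sign_mx_O.
have S1 : in_SO (1%:M : 'M[R]_n) by have [] := @SE_group R n.
apply: connected_component_trans (IH _ _ dI').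
  rewrite IE mulmxA; apply: connected_component_trans (linked_cayley SI' CO sK) _.
  have := linked_cayley SI' S1 sK; rewrite !mulmx1; exact.
apply: leq_trans Im; rewrite (cardsD1 i I) iI add1n ltnS.
by rewrite (cardsD1 j (I :\ i)) leq_addl.
Qed.

(** The chart D cayley S with translation X is joined to (D cayley S, 0), then
    to (D, 0), then to the identity. *)
Lemma SE_connected : connected (SE R n).
Proof.
suff E : SE R n = linked se_one by rewrite E; exact: component_connected.
apply/seteqP; split; last exact: connected_component_sub.
move=> g /covers_se[_ [I /= dI <-] [w _ <-]]; apply: connected_component_sym.
have CO := cayley_SO (skew_mxP (lsubmx w)).
have SI : in_SO (sgn I) by split=> //; exact: sign_mx_O.
have S1 : in_SO (1%:M : 'M[R]_n) by have [] := @SE_group R n.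
apply: connected_component_trans (linked_sign dI).
apply: connected_component_trans (linked_translation _ (SO_mul SI CO)) _.
by have := linked_cayley SI S1 (skew_mxP (lsubmx w)); rewrite !mulmx1.
Qed.

End Connectedness.

(** * The affine symmetric space *)

Section AffineSymmetricSpaceSE.
Context {R : realType} (p q : nat).
Local Notation n := (p + q)%N.
Local Notation aff := ('M[R]_n * 'cV[R]_n)%type.
Local Notation J := (@Jpq R p q).
Local Notation mparams M := (@mparam _ _ M).
Local Notation H := (SOpOq_Rq R p q).
Local Notation sigma := (@sigma R p q).

Lemma Jpq_conj (A : 'M[R]_n) : J *m A *m J =
  block_mx (ulsubmx A) (- ursubmx A) (- dlsubmx A) (drsubmx A).
Proof.
rewrite -{1}[A]submxK /Jpq !mulmx_block.
by rewrite !(mulmx0, mul0mx, addr0, add0r, mulNmx, mulmxN, mul1mx, mulmx1, opprK).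
Qed.

Lemma Jpq_col (X : 'cV[R]_n) : J *m X = col_mx (- usubmx X) (dsubmx X).
Proof.
by rewrite -{1}[X]vsubmxK mul_block_col !mul0mx addr0 add0r mulNmx !mul1mx.
Qed.

Lemma eq_opp0 k l (A : 'M[R]_(k, l)) : - A = A -> A = 0.
Proof.
move=> AN; apply/matrixP => i j; have /matrixP/(_ i j) := AN; rewrite !mxE => /eqP.
by rewrite eq_sym -subr_eq0 opprK -mulr2n mulrn_eq0 => /eqP.
Qed.

(** Conjugation by J negates the off-diagonal blocks and multiplication by J
    negates the first block of a vector, so these vanish at a fixed point. *)
Lemma SOpOq_Rq_fixed : H = fixed_points (SE R n) sigma.
Proof.
apply/seteqP; split=> [_ [A [B [X [AO BO d ->]]]]|[A X] [[/= AO dA] [EA EX]]].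
  split; last first.
    rewrite /Defs.sigma /= Jpq_conj Jpq_col block_mxKul block_mxKur block_mxKdl.
    by rewrite block_mxKdr col_mxKu col_mxKd !oppr0.
  split; last by rewrite /= det_ublock.
  rewrite /in_O /= tr_block_mx mulmx_block !trmx0 !(mulmx0, mul0mx, addr0, add0r).
  by rewrite AO BO -scalar_mx_block.
have EA' : J *m A *m J = block_mx (ulsubmx A) (ursubmx A) (dlsubmx A) (drsubmx A).
  by rewrite EA submxK.
move: EA'; rewrite Jpq_conj => /eq_block_mx[_ /eq_opp0 ur0 /eq_opp0 dl0 _].
have EX' : J *m X = col_mx (usubmx X) (dsubmx X) by rewrite EX vsubmxK.
move: EX'; rewrite Jpq_col => /eq_col_mx[/eq_opp0 u0 _].
have AE : A = block_mx (ulsubmx A) 0 0 (drsubmx A) by rewrite -ur0 -dl0 submxK.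
exists (ulsubmx A), (drsubmx A), (dsubmx X).
move: AO; rewrite /in_O {1 2}AE tr_block_mx mulmx_block !trmx0.
rewrite !(mulmx0, mul0mx, addr0, add0r) (scalar_mx_block p q 1).
move=> /eq_block_mx[a1 _ _ a2]; split=> //.
- by rewrite -dA [in RHS]AE det_ublock.
- by rewrite -AE -u0 vsubmxK.
Qed.

Lemma sigma_SE g : SE R n g -> SE R n (sigma g).
Proof.
move=> [gO dg]; split; last first.
  by rewrite /= !det_mulmx dg mulr1 -det_mulmx Jpq_sqr det1.
rewrite /in_O /= !trmx_mul Jpq_tr !mulmxA -(mulmxA (J *m g.1) J J) Jpq_sqr mulmx1.
by rewrite -(mulmxA J) gO mulmx1 Jpq_sqr.
Qed.

Lemma sigma_mul g h : sigma (se_mul g h) = se_mul (sigma g) (sigma h).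
Proof.
rewrite /Defs.sigma /se_mul /=; congr pair.
  by rewrite !mulmxA -(mulmxA (J *m g.1) J J) Jpq_sqr mulmx1.
by rewrite mulmxDr !mulmxA -(mulmxA (J *m g.1) J J) Jpq_sqr mulmx1.
Qed.

Lemma sigmaK g : sigma (sigma g) = g.
Proof.
case: g => A X; rewrite /Defs.sigma /= !mulmxA Jpq_sqr !mul1mx.
by rewrite -mulmxA Jpq_sqr mulmx1.
Qed.

Lemma sigma_one : sigma se_one = se_one.
Proof. by rewrite /Defs.sigma /= mulmx1 Jpq_sqr mulmx0. Qed.

Lemma SE_affine_symmetric_space :
  affine_symmetric_space (SE R n) (se_dim n) se_mul se_one se_inv H sigma.
Proof.
have [G1 Gm Gv Ga Gu] := @SE_group R n; have oT := @openT aff.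
have ssig : smooth_on setT sigma.
  have s1 := @smooth_affine_fst R n; have s2 := @smooth_affine_snd R n.
  have sJ : smooth_on setT (fun=> J : 'M[R]_n) := @smooth_cst _ aff _ _ _.
  apply: smooth_pair => //; [exact: findim_mx|exact: findim_mx| | ].
    by apply: smooth_mulmx => //; exact: smooth_mulmx.
  exact: smooth_mulmx.
have s1 := sigma_one.
split.
- exact: SE_lie_group.
- exact: SE_connected.
- apply: (smooth_map_ambient (@embedded_SE R n) (@embedded_SE R n) ssig).
  by move=> g Gg; split=> //; exact: sigma_SE.
- by move=> g h _ _; exact: sigma_mul.
- by move=> g _; exact: sigmaK.
- rewrite SOpOq_Rq_fixed; split=> //.
  + by move=> g [].
  + by move=> g h [Gg sg] [Gh sh]; split; [exact: Gm|rewrite sigma_mul sg sh].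
  + move=> g [Gg sg]; split; first exact: Gv.
    have Gsv := sigma_SE (Gv _ Gg); have [l1 _ _ _] := Gu _ Gsv.
    have [_ r1 gV gV'] := Gu _ Gg.
    have [_ r1' _ _] := Gu _ Gsv; have [l1v _ _ _] := Gu _ (Gv _ Gg).
    rewrite -[LHS]l1 -gV -[X in se_mul (se_mul _ X)]sg -Ga//; last 2 first.
    + exact: Gv.
    + exact: sigma_SE.
    by rewrite -sigma_mul gV' s1; have [_ ->] := Gu _ (Gv _ Gg).
- rewrite SOpOq_Rq_fixed.
  have sd : smooth_on setT (fun g : aff => sigma g - g).
    by apply: smoothB => //; apply: smooth_linear => //; exact: findim_aff.
  exists ((fun g : aff => sigma g - g) @^-1` [set 0]).
    apply: closed_comp; first by move=> g _; exact: smooth_cont sd _.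
    exact: (@accessible_closed_set1 _ (hausdorff_accessible (@norm_hausdorff _ _))).
  apply/seteqP; split=> g [Gg /= sg]; split=> //=; first by rewrite sg subrr.
  exact/subr0_eq.
- by rewrite SOpOq_Rq_fixed.
- by rewrite SOpOq_Rq_fixed; exact: connected_component_sub.
Qed.

End AffineSymmetricSpaceSE.

(** * The orbit and the cosets of the stabilizer *)

Section PushManifold.
Context {R : realType}.
Local Notation mparams M := (@mparam _ _ M).

(** Transport of the structure of M along phi, which is to be injective on M. *)
Definition push_manifold {T T' : Type} (M : @premanifold R T) (phi : T -> T') :
    @premanifold R T' :=
  @PreManifold R T' (phi @` mpoints M) (mdim M)
    [set LocalParam (pdom a) (fun u => phi (pfun a u)) | a in mparams M].

Lemma embedded_push {T T'} (M : @premanifold R T) {E : normedModType R}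
    (e : T -> E) (phi : T -> T') (psi : T' -> T) : embedded M e ->
  (forall x, mpoints M x -> psi (phi x) = x) ->
  embedded (push_manifold M phi) (fun y => e (psi y)).
Proof.
move=> [fE eM] K; split=> // _ [a Ma <-]; have [oa aM sa loc] := eM _ Ma.
split=> //=.
- by move=> u au; exists (pfun a u) => //; exact: aM.
- by apply: smooth_eq sa => // u au; rewrite K//; exact: aM.
move=> u au; have [ O [g [oO Ou sg gM gK]]] := loc u au; exists O, g; split=> //.
- by rewrite K//; exact: aM.
- by move=> _ [x Mx <-] Ox; rewrite K// in Ox *; have [? ->] := gM _ Mx Ox.
- by move=> w aw; rewrite K; [exact: gK|exact: aM].
Qed.

Lemma push_is_manifold {T T'} (M : @premanifold R T) {E : normedModType R}
    (e : T -> E) (phi : T -> T') (psi : T' -> T) : embedded M e ->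
  (forall x, mpoints M x -> psi (phi x) = x) -> is_manifold M ->
  is_manifold (push_manifold M phi).
Proof.
move=> eM K mM; have [A [cA AM covA]] := manifold_second_countable mM.
pose f (a : @local_param R T (mdim M)) 
    : @local_param R T' (mdim (push_manifold M phi)) :=
  LocalParam (pdom a) (fun u => phi (pfun a u)).
apply: (embedded_manifold (A := f @` A) (embedded_push eM K)).
- exact: card_le_trans (card_image_le f A) cA.
- by move=> _ [a /AM Ma <-]; exists a.
- move=> _ [x /covA[a Aa [u au <-]] <-]; exists (f a); first by exists a.
  by exists u.
Qed.

End PushManifold.

Section Quotient.
Context {R : realType} (p q : nat) (hp : (0 < p)%N).
Local Notation n := (p + q)%N.
Local Notation aff := ('M[R]_n * 'cV[R]_n)%type.
Local Notation bundle := ({vspace 'cV[R]_n} * 'cV[R]_n)%type.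
Local Notation J := (@Jpq R p q).
Local Notation mparams M := (@mparam _ _ M).
Local Notation H := (SOpOq_Rq R p q).
Local Notation sigma := (@sigma R p q).
Local Notation o := (@base_pt R p q).
Local Notation G := (SE R n).
Local Notation Gman := (SE_manifold R n).
Local Notation Cman := (C_manifold R p q).

Lemma smooth_bullet_poly : smooth_on setT (@bullet_poly R p q).
Proof.
have oT := @openT (aff * aff)%type.
have s11 := @smooth_fst_fst R n n; have s12 := @smooth_fst_snd R n n.
have s21 := @smooth_snd_fst R n n; have s22 := @smooth_snd_snd R n n.
have sJ : smooth_on setT (fun=> J) := @smooth_cst _ (aff * aff)%type _ _ _.
have sA : smooth_on setT (fun z : aff * aff => z.1.1 *m z.2.1 *m J *m z.1.1^T).
  apply: smooth_mulmx => //; last exact: smooth_trmx.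
  by apply: smooth_mulmx => //; exact: smooth_mulmx.
apply: smooth_pair => //; [exact: findim_mx|exact: findim_mx|exact: smooth_mulmx|].
apply: smoothB => //; last exact: smooth_mulmx.
by apply: smoothD => //; exact: smooth_mulmx.
Qed.

Lemma star_smooth_action :
  is_smooth_action Gman se_mul se_one Cman star.
Proof.
split; first exact: star_action.
have eC := @embedded_bundle R p q; have eGC := embedded_prod (@embedded_SE R n) eC.
apply: (smooth_map_ambient eGC eC smooth_bullet_poly) => -[g x] [[gO _] Cx].
by split=> /=; [exact: star_Cnp|rewrite kappa_star// se_bulletE].
Qed.

Lemma Sp_kappa : Sp R p q = (@kappa R p q) @` Cnp R p q.
Proof.
apply/seteqP; split=> [_ [g [gO dg] <-]|_ [x Cx <-]].
  exists (star g o); first by apply: star_Cnp => //; exact: base_pt_Cnp.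
  by rewrite kappa_star// kappa_base.
have [_ /(_ o x (@base_pt_Cnp R p q) Cx)[g Gg <-]] := @star_transitive R p q hp.
by exists g => //; rewrite kappa_star ?kappa_base//; case: Gg.
Qed.

Lemma Sp_is_manifold : is_manifold (Sp_manifold R p q).
Proof.
have eS : embedded (Sp_manifold R p q) id.
  by apply: embedded_submanifold; exact: findim_aff.
pose f (a : @local_param R bundle (bundle_dim p q)) :
    @local_param R aff (mdim (Sp_manifold R p q)) :=
  LocalParam (pdom a) (fun u => kappa (pfun a u)).
apply: (embedded_manifold (A := f @` range (@bundle_param R p q)) eS).
- apply: finite_set_countable; do 2 apply: finite_image; exact: finite_finset.
- move=> _ [_ [s _ <-] <-]; split=> /=.
  + exact: openT.
  + exact: smooth_bundle_param.
  + exists (chart_dom s); first exact: open_chart_dom.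
    apply/seteqP; split=> [_ [w _ <-]|y []].
      split; last exact: chart_dom_param.
      rewrite Sp_kappa; exists (pfun (bundle_param s) w) => //.
      exact: bundle_param_Cnp.
    rewrite Sp_kappa => -[x Cx <-] dx; exists (chart_inv s (kappa x)) => //.
    by congr kappa; exact: chart_paramK.
  exists (chart_inv s); split; last by move=> w _; exact: chart_invK.
  move=> _ [w _ <-]; exists (chart_dom s), (chart_inv s); split=> //.
  + exact: open_chart_dom.
  + exact: chart_dom_param.
  + exact: smooth_chart_inv.
- move=> y; rewrite /= Sp_kappa => -[x /covers_bundle[a Ra [u au <-]] <-].
  by exists (f a); [exists a|exists u].
Qed.

Lemma rho_diffeomorphism : diffeomorphism (Sp_manifold R p q) Cman (@rho R p q).
Proof.
have eS : embedded (Sp_manifold R p q) id.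
  by apply: embedded_submanifold; exact: findim_aff.
have eC := @embedded_bundle R p q.
have sid : smooth_on setT (@id aff).
  by apply: smooth_linear => //; [exact: findim_aff|exact: openT].
split; [exact: Sp_is_manifold|exact: bundle_manifold| | ].
  apply: (smooth_map_ambient eS eC sid) => y.
  by rewrite /= Sp_kappa => -[x Cx <-]; rewrite rho_kappa.
exists (@kappa R p q); split.
- apply: (smooth_map_ambient eC eS sid) => x Cx; split=> //=.
  by rewrite Sp_kappa; exists x.
- by move=> y; rewrite /= Sp_kappa => -[x _ <-]; rewrite rho_kappa.
- by move=> x _; exact: rho_kappa.
Qed.

Lemma rho_equivariant g x : G g -> Sp R p q x ->
  rho (se_bullet g x) = star g (rho x).
Proof.
move=> [gO _]; rewrite Sp_kappa => -[y _ <-].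
by rewrite -kappa_star// !rho_kappa.
Qed.

(** Under kappa the equation reads g sigma (g^-1) = 1, that is g = sigma g. *)
Lemma stabilizer_base g : G g -> star g o = o <-> H g.
Proof.
move=> Gg; have [G1 Gm Gv Ga Gu] := @SE_group R n.
have [_ g1 gV gV'] := Gu _ Gg; rewrite SOpOq_Rq_fixed.
have -> : star g o = o <-> se_bullet g se_one = se_one.
  rewrite -(@kappa_base R p q) -kappa_star; last by case: Gg.
  by split=> [-> //|E]; rewrite -[LHS]rho_kappa E rho_kappa.
have Gs := sigma_SE Gg; have Gsv := sigma_SE (Gv _ Gg).
have s1 := @sigma_one R p q.
rewrite /se_bullet /twisted_conj g1; split=> [E|[_ E]].
  split=> //; have := congr1 (fun z => se_mul z (sigma g)) E.
  rewrite -Ga// -sigma_mul gV s1 g1; have [-> _ _ _] := Gu _ Gs.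
  by move=> <-.
by rewrite -[X in se_mul X]E -sigma_mul gV' s1.
Qed.

(** The coset that corresponds to a point of the bundle. *)
Definition orbit_fibre (x : bundle) : set aff := [set h | G h /\ star h o = x].

Lemma left_translate_fibre g :
  G g -> left_translate se_mul g H = orbit_fibre (star g o).
Proof.
move=> Gg; have [G1 Gm Gv Ga Gu] := @SE_group R n.
have [_ act1 actM] := @star_action R p q; have Co := @base_pt_Cnp R p q.
apply/seteqP; split=> [_ [h Hh <-]|h [Gh hE]].
  have Gh : G h by move: Hh; rewrite SOpOq_Rq_fixed => -[].
  split; first exact: Gm.
  by rewrite actM// ((stabilizer_base Gh).2 Hh).
have Gk : G (se_mul (se_inv g) h) by apply: Gm => //; exact: Gv.
have [l1 _ _ gV'] := Gu _ Gg; have [_ _ gV _] := Gu _ Gg.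
exists (se_mul (se_inv g) h).
  apply/stabilizer_base => //; rewrite actM//; last exact: Gv.
  by rewrite hE -actM ?gV ?act1//; exact: Gv.
by rewrite Ga ?gV'//; [have [] := Gu _ Gh|exact: Gv].
Qed.

(** Inverse to orbit_fibre on cosets; the default value of xget is not
    reached, since cosets are inhabited. *)
Definition coset_point (A : set aff) : bundle := star (xget se_one A) o.

Lemma coset_pointK x : Cnp R p q x -> coset_point (orbit_fibre x) = x.
Proof.
move=> Cx.
have [_ /(_ o x (@base_pt_Cnp R p q) Cx)[g Gg gE]] := @star_transitive R p q hp.
have : exists h, orbit_fibre x h by exists g.
by move=> /(xgetPex se_one)[].
Qed.

Lemma left_cosetsE : left_cosets G se_mul H = orbit_fibre @` Cnp R p q.
Proof.
apply/seteqP; split=> [_ [g Gg <-]|_ [x Cx <-]].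
  exists (star g o); last by rewrite left_translate_fibre.
  by apply: star_Cnp; [case: Gg|exact: base_pt_Cnp].
have [_ /(_ o x (@base_pt_Cnp R p q) Cx)[g Gg <-]] := @star_transitive R p q hp.
by exists g => //; rewrite left_translate_fibre.
Qed.

Lemma coset_point_translate g :
  G g -> coset_point (left_translate se_mul g H) = star g o.
Proof.
move=> Gg; rewrite left_translate_fibre// coset_pointK//.
by apply: star_Cnp; [case: Gg|exact: base_pt_Cnp].
Qed.

Lemma smooth_orbit_bullet :
  smooth_on setT (fun g : aff => @bullet_poly R p q (g, se_one)).
Proof.
have oT := @openT aff.
have sF : smooth_on setT (fun g : aff => (g, se_one : aff)).
  apply: smooth_pair => //; [exact: findim_aff|exact: findim_aff| |exact: smooth_cst].
  by apply: smooth_linear => //; exact: findim_aff.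
apply: (smooth_comp (Q := setT)) sF smooth_bullet_poly => //; last exact: openT.
by apply: findim_prod; exact: findim_aff.
Qed.

Lemma smooth_orbit_map : smooth_map Gman Cman setT (fun g => star g o).
Proof.
have [actC _ _] := @star_action R p q; have Co := @base_pt_Cnp R p q.
apply: (smooth_map_ambient (@embedded_SE R n) (@embedded_bundle R p q)
  smooth_orbit_bullet) => g Gg; split; first exact: actC.
by rewrite kappa_star ?kappa_base ?se_bulletE//; case: Gg.
Qed.

Definition local_section (s : 'S_n) (x : bundle) : aff :=
  bundle_sec s (chart_inv s (kappa x)).

Lemma local_sectionP s x : Cnp R p q x -> chart_dom s (kappa x) ->
  G (local_section s x) /\ star (local_section s x) o = x.
Proof.
move=> Cx dx; split; first exact: bundle_sec_SE.
by rewrite bundle_secP chart_paramK.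
Qed.

Lemma smooth_chart_section s :
  smooth_on (chart_dom s) (fun y : aff => bundle_sec s (chart_inv s y)).
Proof.
apply: (smooth_comp (Q := setT)) => //; last exact: smooth_bundle_sec.
- exact: findim_mx.
- exact: open_chart_dom.
- exact: openT.
- exact: smooth_chart_inv.
Qed.

End Quotient.

(** * The quotient manifold *)

Section QuotientManifold.
Context {R : realType} (p q : nat) (hp : (0 < p)%N).
Local Notation n := (p + q)%N.
Local Notation aff := ('M[R]_n * 'cV[R]_n)%type.
Local Notation bundle := ({vspace 'cV[R]_n} * 'cV[R]_n)%type.
Local Notation H := (SOpOq_Rq R p q).
Local Notation o := (@base_pt R p q).
Local Notation G := (SE R n).
Local Notation Gman := (SE_manifold R n).
Local Notation Cman := (C_manifold R p q).
Local Notation kap := (@kappa R p q).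
Local Notation cpt := (@coset_point R p q).

Definition chart_region (s : 'S_n) : set bundle :=
  Cnp R p q `&` kap @^-1` chart_dom s.

Lemma mopen_chart_region s : mopen Cman (chart_region s).
Proof.
exact: (embedded_mopen (@embedded_bundle R p q) (@open_chart_dom R p q s)).
Qed.

Lemma smooth_local_section s :
  smooth_map Cman Gman (chart_region s) (local_section s).
Proof.
have eC := @embedded_bundle R p q.
apply: (embedded_smooth_map eC (@embedded_SE R n)) => x Cx [_ dx].
exists (chart_dom s), (fun y => bundle_sec s (chart_inv s y)); split=> //.
- exact: open_chart_dom.
- exact: smooth_chart_section.
by move=> y Cy dy; split=> //; have [] := local_sectionP hp Cy dy.
Qed.

Definition coset_manifold := push_manifold Cman (@orbit_fibre R p q).

Lemma embedded_coset :
  embedded coset_manifold (fun A => kap (cpt A)).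
Proof.
apply: (embedded_push (@embedded_bundle R p q)) => x Cx; exact: coset_pointK.
Qed.

Lemma coset_is_manifold : is_manifold coset_manifold.
Proof.
apply: (push_is_manifold (psi := cpt) (@embedded_bundle R p q)).
  by move=> x Cx; exact: coset_pointK.
exact: bundle_manifold.
Qed.

Lemma coset_quotient : is_quotient_manifold Gman se_mul H coset_manifold.
Proof.
have eQ := embedded_coset; have [actC _ _] := @star_action R p q.
have Co := @base_pt_Cnp R p q.
split; [exact: coset_is_manifold|by rewrite left_cosetsE| | ].
  apply: (smooth_map_ambient (@embedded_SE R n) eQ
    (F := fun g => @bullet_poly R p q (g, se_one))).
    exact: smooth_orbit_bullet.
  move=> g Gg; split.
    by exists (star g o); [exact: actC|rewrite left_translate_fibre].
  by rewrite coset_point_translate// kappa_star ?kappa_base ?se_bulletE//; case: Gg.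
move=> _ [x Cx <-]; have [s dx] := chart_dom_exists Cx.
exists (mpoints coset_manifold `&`
    (fun A => kap (cpt A)) @^-1` chart_dom s),
  (fun A => local_section s (cpt A)); split.
- exact: (embedded_mopen eQ (@open_chart_dom R p q s)).
- by split; [exists x|rewrite /= coset_pointK].
- apply: (embedded_smooth_map eQ (@embedded_SE R n)) => _ [y Cy <-] [_ dy].
  exists (chart_dom s), (fun y => bundle_sec s (chart_inv s y)); split=> //.
  + exact: open_chart_dom.
  + exact: smooth_chart_section.
  move=> _ [z Cz <-] dz; split=> //; rewrite coset_pointK// in dz *.
  by have [] := local_sectionP hp Cz dz.
move=> _ [[y Cy <-] /= dy]; rewrite coset_pointK// in dy *.
by have [Gs sE] := local_sectionP hp Cy dy; rewrite left_translate_fibre// sE.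
Qed.

Context (Q : @premanifold R (set aff)).
Context (quoQ : is_quotient_manifold Gman se_mul H Q).

Lemma quotient_points : mpoints Q = @orbit_fibre R p q @` Cnp R p q.
Proof. by have [_ -> _ _] := quoQ; exact: left_cosetsE. Qed.

(** On the domain of a local section t of the projection, the map is the orbit
    map composed with t. *)
Lemma smooth_coset_point : smooth_map Q Cman setT cpt.
Proof.
have [mQ _ _ loc] := quoQ; apply: smooth_map_local => // x Qx.
have [W [t [oW Wx st tP]]] := loc x Qx.
exists W, (fun y => star (t y) o); split=> //.
  exact: (smooth_map_comp mQ (@SE_is_manifold R n) st (@smooth_orbit_map R p q)).
move=> y Wy; have Gt : G (t y) by apply: st.1 => //; exact: oW.1.
by rewrite -{2}(tP y Wy) coset_point_translate.
Qed.

(** On a chart region, the map is the projection composed with the local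
    section of the orbit map. *)
Lemma smooth_orbit_fibre : smooth_map Cman Q setT (@orbit_fibre R p q).
Proof.
have [mQ _ spi _] := quoQ; have mC := @bundle_manifold R p q.
apply: smooth_map_local => // x Cx; have [s dx] := chart_dom_exists Cx.
exists (chart_region s), (fun y => left_translate se_mul (local_section s y) H).
split=> //; first exact: mopen_chart_region.
  exact: (smooth_map_comp mC (@SE_is_manifold R n) (@smooth_local_section s) spi).
move=> y [Cy dy]; have [Gs sE] := local_sectionP hp Cy dy.
by rewrite left_translate_fibre// sE.
Qed.

Lemma coset_point_diffeomorphism : diffeomorphism Q Cman cpt.
Proof.
have [mQ _ _ _] := quoQ.
split; [by []|exact: bundle_manifold|exact: smooth_coset_point|].
exists (@orbit_fibre R p q); split; first exact: smooth_orbit_fibre.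
- by rewrite quotient_points => _ [x Cx <-]; rewrite coset_pointK.
- by move=> y Cy; exact: coset_pointK.
Qed.

Lemma coset_point_equivariant g x : G g -> mpoints Q x ->
  cpt (left_translate se_mul g x) = star g (cpt x).
Proof.
move=> Gg; have [_ -> _ _] := quoQ; move=> [h Gh <-].
have [G1 Gm Gv Ga Gu] := @SE_group R n; have [_ act1 actM] := @star_action R p q.
have Co := @base_pt_Cnp R p q.
have -> : left_translate se_mul g (left_translate se_mul h H) =
    left_translate se_mul (se_mul g h) H.
  have HG k : H k -> G k by rewrite SOpOq_Rq_fixed => -[].
  apply/seteqP; split=> [_ [_ [k Hk <-] <-]|_ [k Hk <-]].
    by exists k => //; rewrite Ga//; exact: HG.
  by exists (se_mul h k); [exists k|rewrite Ga//; exact: HG].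
by rewrite !coset_point_translate//; [rewrite actM|exact: Gm].
Qed.

Lemma Cnp_unbounded (K : R) : exists2 x, Cnp R p q x & K <= `|x.2|.
Proof.
pose v : 'cV[R]_n := @base_frame R p q *m const_mx 1.
have v0 : 0 < `|v|.
  rewrite normr_gt0; apply/eqP => /base_frame_inj/matrixP/(_ (Ordinal hp) 0).
  by rewrite !mxE => /eqP; rewrite oner_eq0.
(* A multiple of a nonzero vector of the plane with norm equal to |K|. *)
exists (@base_plane R p q, (K / `|v|) *: v).
  split; first by case: (@base_pt_Cnp R p q).
  by apply: memvZ; apply/mem_mx_span; exists (const_mx 1).
by rewrite /= normrZ normrM normfV normr_id mulfVK ?gt_eqF// ler_norm.
Qed.

(** The sets where the vector has norm less than k form an increasing open
    cover.  A finite subcover would bound the norm on the whole bundle. *)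
Lemma quotient_not_compact : ~ mcompact Q.
Proof.
move=> cQ; have [mQ _ _ _] := quoQ; have mC := @bundle_manifold R p q.
pose B (k : nat) : set aff := [set y | `|y.2| < k%:R].
have oB k : open (B k).
  have cn : continuous (fun y : aff => `|y.2|).
    move=> y; apply: (continuous_comp (f := snd)); first exact: cvg_snd.
    exact: norm_continuous.
  apply: (@open_comp _ _ (fun y : aff => `|y.2|) [set r | r < k%:R]).
    by move=> y _; exact: cn.
  exact: open_lt.
pose Ok k := mpoints Q `&` cpt @^-1` (Cnp R p q `&` kap @^-1` B k).
have oOk k : mopen Q (Ok k).
  apply: smooth_map_mopen mQ mC smooth_coset_point _.
  exact: (embedded_mopen (@embedded_bundle R p q) (oB k)).
have OkP k x : Cnp R p q x -> Ok k (orbit_fibre x) -> `|x.2| < k%:R.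
  by move=> Cx [_ [_]]; rewrite /preimage /= coset_pointK.
have oRange O : range Ok O -> mopen Q O by move=> [k _ <-].
have covOk : mpoints Q `<=` \bigcup_(O in range Ok) O.
  rewrite quotient_points => _ [x Cx <-].
  pose k := (Num.truncn `|x.2|).+1.
  exists (Ok k); first by exists k.
  split; first by rewrite quotient_points; exists x.
  rewrite /preimage /= coset_pointK//; split=> //=.
  by rewrite /B /= truncnS_gt.
have [F' [finF subF covF]] := cQ _ oRange covOk.
have [s sE] := (finite_seqP F').1 finF.
have [K KP] : exists K, forall A, A \in s -> A `<=` Ok K.
  have : forall A, A \in s -> range Ok A by move=> A As; apply: subF; rewrite sE.
  elim: (s) => [_|A t IH sub]; first by exists 0%N.
  have [k _ kE] := sub A (mem_head _ _).
  have [|K KP] := IH; first by move=> A' tA'; apply: sub; rewrite inE tA' orbT.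
  (* As the cover is increasing, the member of largest index contains the others. *)
  have mono k1 k2 : (k1 <= k2)%N -> Ok k1 `<=` Ok k2.
    move=> le12 x [Qx [Cx Bx]]; split=> //; split=> //.
    by apply: lt_le_trans Bx _; rewrite ler_nat.
  exists (maxn k K) => A'; rewrite inE => /predU1P[->|/KP sA'].
    by rewrite -kE; apply: mono; exact: leq_maxl.
  by apply: subset_trans sA' _; apply: mono; exact: leq_maxr.
have [x Cx Kx] := Cnp_unbounded K%:R.
have Qx : mpoints Q (orbit_fibre x) by rewrite quotient_points; exists x.
have [A FA Ax] := covF _ Qx.
have As : A \in s by move: FA; rewrite sE.
by have := OkP _ _ Cx (KP A As _ Ax); rewrite ltNge Kx.
Qed.

End QuotientManifold.

Theorem theorem2 (R : realType) (p q : nat) (hp : (0 < p)%N) (hq : (0 < q)%N) :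
  (* the formula defines a transitive action on C_{n,p} *)
  (is_smooth_action (SE_manifold R (p + q)) se_mul se_one (C_manifold R p q) star /\
   transitive_action (SE R (p + q)) (Cnp R p q) star) /\
  (* rho is an equivariant diffeomorphism *)
  (diffeomorphism (Sp_manifold R p q) (C_manifold R p q) (@rho R p q) /\
   (forall g x, SE R (p + q) g -> Sp R p q x ->
      rho (se_bullet g x) = star g (rho x))) /\
  (* the affine symmetric space *)
  (affine_symmetric_space (SE R (p + q)) (se_dim (p + q)) se_mul se_one se_inv
     (SOpOq_Rq R p q) (@sigma R p q) /\
   SOpOq_Rq R p q = fixed_points (SE R (p + q)) (@sigma R p q)) /\
  (* C_{n,p} is equivariantly diffeomorphic to the quotient, not compact *)
  ((exists Q, is_quotient_manifold (SE_manifold R (p + q)) se_mul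
                (SOpOq_Rq R p q) Q) /\
   (forall Q, is_quotient_manifold (SE_manifold R (p + q)) se_mul
                (SOpOq_Rq R p q) Q ->
      ~ mcompact Q /\
      exists F : set ('M[R]_(p + q) * 'cV[R]_(p + q)) ->
                 {vspace 'cV[R]_(p + q)} * 'cV[R]_(p + q),
        diffeomorphism Q (C_manifold R p q) F /\
        (forall g x, SE R (p + q) g -> mpoints Q x ->
           F (left_translate se_mul g x) = star g (F x)))).
Proof.
split; first by split; [exact: star_smooth_action|exact: star_transitive].
split; first by split; [exact: rho_diffeomorphism|exact: rho_equivariant].
split.
  by split; [exact: SE_affine_symmetric_space|exact: SOpOq_Rq_fixed].
split; first by exists (@coset_manifold R p q); exact: coset_quotient.
move=> Q quoQ; split; first exact: quotient_not_compact quoQ.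
exists (@coset_point R p q); split; first exact: coset_point_diffeomorphism.
by move=> g x; exact: (coset_point_equivariant hp quoQ).
Qed.
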